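(* Let $\mathbb{T}=\mathbb{T}_N$ be a modified hierarchical T-mesh, with meshes $\mathbb{T}_0,\dots,\mathbb{T}_N$, such that in every refinement step from $\mathbb{T}_k$ to $\mathbb{T}_{k+1}$ no T-vertex changes into a crossing vertex and a new basis vertex appears for each subdivided cell. Let $\mathcal{S}=\mathcal{S}^N$ be the modified PHT-spline basis over $\mathbb{T}$ constructed recursively as described in the context. Then: a) the functions in $\mathcal{S}$ are linearly independent; b) $\mathcal{S}$ spans the modified PHT-spline space $\mathcal{S}(3,3,1,1,\mathbb{T})$; c) $\mathcal{S}$ forms a partition of unity, i.e. the sum of all functions in $\mathcal{S}$ is identically $1$ on the domain.
   Context: **T-meshes.** A T-mesh is a rectangular grid that allows T-junctions: except at the corners of the domain, the endpoints of each grid line lie on two other grid lines, and each cell is a rectangle. Grid points are vertices. A vertex on the boundary of the domain is a boundary vertex; the other vertices are interior vertices, and each of these is either a crossing vertex (grid lines leave it in all four axis directions) or a T-vertex (in exactly three). A basis vertex is a boundary vertex or an interior crossing vertex. **Modified hierarchical T-meshes.** Start with a tensor-product mesh $\mathbb{T}_0$ and let $\mathcal{F}_0$ be the set of all its cells. For $k=0,1,\dots,N-1$, choose $\Theta_k\subset\mathcal{F}_k$ and subdivide each cell in $\Theta_k$ either by inserting a cross (four subcells, through the midpoints), or by splitting it in half by a single horizontal edge, or by splitting it in half by a single vertical edge. This gives $\mathbb{T}_{k+1}$; let $\mathcal{F}_{k+1}$ be the set of all new cells that emerge by this subdivision. The mesh is $\mathbb{T}=\mathbb{T}_N$. A new basis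 vertex at level $k+1$ is a basis vertex of $\mathbb{T}_{k+1}$ that is not a basis vertex of $\mathbb{T}_k$; it appears for a cell if it lies on or in that cell. **Spline space.** Let $\Omega$ be the region occupied by the cells of $\mathbb{T}$. Then $\mathcal{S}(3,3,1,1,\mathbb{T})$ is the space of functions $s\in C^{1,1}(\Omega)$ whose restriction to every cell of $\mathbb{T}$ is a polynomial of bi-degree $(3,3)$, where $C^{\alpha,\beta}(\Omega)$ denotes the bivariate functions continuous in $\Omega$ with order $\alpha$ in the $x$-direction and order $\beta$ in the $y$-direction. Known dimension formula: $\dim\mathcal{S}(3,3,1,1,\mathbb{T})=4(V^b+V^+)$, where $V^b$ and $V^+$ are the numbers of boundary vertices and interior crossing vertices of $\mathbb{T}$. **Four bicubic functions at a vertex.** Let $(s_i,t_i)$ be a vertex surrounded by a $2\times2$ tensor-product block of cells with horizontal knots $s_{i-1},s_i,s_{i+1}$ and vertical knots $t_{i-1},t_i,t_{i+1}$. For a boundary vertex the missing side is degenerate: $s_{i-1}=s_i$, or $s_i=s_{i+1}$, and similarly in $t$. The four associated functions are the tensor-product bicubic B-splines with knot vectors $\sigma\times\tau$, where $\sigma\in\{[s_{i-1},s_{i-1},s_i,s_i,s_{i+1}],\,[s_{i-1},s_i,s_i,s_{i+1},s_{i+1}]\}$ and $\tau\in\{[t_{i-1},t_{i-1},t_i,t_i,t_{i+1}],\,[t_{i-1},t_i,t_i,t_{i+1},t_{i+1}]\}$. They are the normalized B-splines (those that form a partition of unity), extended by zero outside the block. **Modification operator.** Let $b$ be a basis function at level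 $k$. For each cell $\theta\in\Theta_k$ with $\theta\subset\mathrm{supp}(b)$: 1) represent $b$ over $\theta$ by its 16 bicubic Bézier ordinates; 2) compute the Bézier ordinates of $b$ on the subcells of $\theta$ (two or four, according to the subdivision type of $\theta$) by de Casteljau's algorithm; 3) set to zero all Bézier ordinates associated with new basis vertices of level $k+1$. Here the $4\times4$ Bézier ordinates on a cell are divided into four $2\times2$ blocks, each associated with the nearest corner vertex of the cell. The resulting function is $\mathfrak{M}^{k+1}(b)$. If no cell of $\Theta_k$ is contained in $\mathrm{supp}(b)$, then $\mathfrak{M}^{k+1}(b)=b$. **New basis functions.** For each new basis vertex of level $k+1$, the neighbouring cells of level $k+1$ (four for an interior vertex, two for a boundary vertex) form a tensor-product mesh. Write the vertex as $(s_i,t_i)$ and let $s_{i-1},s_i,s_{i+1}$ and $t_{i-1},t_i,t_{i+1}$ be the horizontal and vertical knots of this mesh (with $s_{i-1}=s_i$ or $s_i=s_{i+1}$, and similarly in $t$, on a missing side of a boundary vertex). The new basis functions at level $k+1$ associated with the vertex are the four normalized tensor-product bicubic B-splines with knot vectors $\sigma\times\tau$, where $\sigma\in\{[s_{i-1},s_{i-1},s_i,s_i,s_{i+1}],\,[s_{i-1},s_i,s_i,s_{i+1},s_{i+1}]\}$ and $\tau\in\{[t_{i-1},t_{i-1},t_i,t_i,t_{i+1}],\,[t_{i-1},t_i,t_i,t_{i+1},t_{i+1}]\}$, extended by zero outside these neighbouring cells. **Recursive construction.** $\mathcal{S}^0$ is the set of $C^1$ tensor-product bicubic B-spline basis functions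 over $\mathbb{T}_0$, i.e. for every vertex $(s_i,t_i)$ of $\mathbb{T}_0$, with $s_{i-1},s_i,s_{i+1}$ and $t_{i-1},t_i,t_{i+1}$ the horizontal and vertical knots of the block of cells of $\mathbb{T}_0$ surrounding it (with $s_{i-1}=s_i$ or $s_i=s_{i+1}$, and similarly in $t$, on a missing side of a boundary vertex), the four normalized tensor-product bicubic B-splines with knot vectors $\sigma\times\tau$, where $\sigma\in\{[s_{i-1},s_{i-1},s_i,s_i,s_{i+1}],\,[s_{i-1},s_i,s_i,s_{i+1},s_{i+1}]\}$ and $\tau\in\{[t_{i-1},t_{i-1},t_i,t_i,t_{i+1}],\,[t_{i-1},t_i,t_i,t_{i+1},t_{i+1}]\}$, extended by zero outside the block. For $k=0,\dots,N-1$, $\mathcal{S}^{k+1}=\mathcal{S}_A^{k+1}\cup\mathcal{S}_B^{k+1}$, where $\mathcal{S}_A^{k+1}=\{\mathfrak{M}^{k+1}(b): b\in\mathcal{S}^k\}$ and $\mathcal{S}_B^{k+1}$ is the set of new basis functions at level $k+1$. Finally $\mathcal{S}=\mathcal{S}^N$. *)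

(* Defs.v *)
(* MathComp-Analysis, over an arbitrary R : realType. *)
From HB Require Import structures.
From mathcomp Require Export all_boot all_order all_algebra.
From mathcomp Require Export all_classical all_reals all_analysis.
Export Order.TTheory GRing.Theory Num.Theory.
Export numFieldNormedType.Exports.

Set Implicit Arguments.
Unset Strict Implicit.
Unset Printing Implicit Defensive.

Global Open Scope classical_set_scope.
Global Open Scope ring_scope.

(* The closed rectangle [xlo, xhi] x [ylo, yhi]. *)
Record cell (R : Type) := Cell { xlo : R; xhi : R; ylo : R; yhi : R }.

Inductive subdivision := Cross | Horizontal | Vertical.

Inductive part := Whole | Lower | Upper.

Section Defs.
Variable R : realType.
Implicit Types (c : cell R) (C Theta : set (cell R)) (v p : R * R).
Implicit Types (f b s : R * R -> R).

Definition in_cell c p : Prop :=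
  (xlo c <= p.1 <= xhi c) && (ylo c <= p.2 <= yhi c).

Definition region C : set (R * R) := [set p | exists2 c, C c & in_cell c p].

Definition corner c v : Prop :=
  (v.1 = xlo c \/ v.1 = xhi c) /\ (v.2 = ylo c \/ v.2 = yhi c).

Definition vertex C v : Prop := exists2 c, C c & corner c v.

Definition boundary_vertex C v : Prop :=
  vertex C v /\ region C v /\ ~ interior (region C) v.

Definition interior_vertex C v : Prop :=
  vertex C v /\ interior (region C) v.

(* A grid line leaves v in a given direction when some cell has an edge along
   this direction that contains v and extends beyond it. *)
Definition leaves_right C v : Prop := exists c,
  C c /\ (v.2 = ylo c \/ v.2 = yhi c) /\ xlo c <= v.1 < xhi c.
Definition leaves_left C v : Prop := exists c,
  C c /\ (v.2 = ylo c \/ v.2 = yhi c) /\ xlo c < v.1 <= xhi c.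
Definition leaves_up C v : Prop := exists c,
  C c /\ (v.1 = xlo c \/ v.1 = xhi c) /\ ylo c <= v.2 < yhi c.
Definition leaves_down C v : Prop := exists c,
  C c /\ (v.1 = xlo c \/ v.1 = xhi c) /\ ylo c < v.2 <= yhi c.

Definition valence C v : nat :=
  (`[< leaves_right C v >] + `[< leaves_left C v >]
   + `[< leaves_up C v >] + `[< leaves_down C v >])%N.

Definition crossing_vertex C v : Prop := interior_vertex C v /\ valence C v = 4%N.

Definition T_vertex C v : Prop := interior_vertex C v /\ valence C v = 3%N.

Definition basis_vertex C v : Prop := boundary_vertex C v \/ crossing_vertex C v.

Definition tensor_mesh (xs ys : seq R) : set (cell R) :=
  [set c | exists i j, [/\ (i.+1 < size xs)%N, (j.+1 < size ys)%N
                         & c = Cell xs`_i xs`_i.+1 ys`_j ys`_j.+1]].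

(* A subcell is addressed by a pair (h1, h2): h1 says which part of the
   x-interval is kept, h2 which part of the y-interval.  A horizontal edge
   halves the y-interval, a vertical edge halves the x-interval. *)
Definition pieces (d : subdivision) : set (part * part) :=
  match d with
  | Cross => [set h | h.1 <> Whole /\ h.2 <> Whole]
  | Horizontal => [set h | h.1 = Whole /\ h.2 <> Whole]
  | Vertical => [set h | h.1 <> Whole /\ h.2 = Whole]
  end.

Definition part_lo (h : part) (a a' : R) : R :=
  if h is Upper then (a + a') / 2 else a.
Definition part_hi (h : part) (a a' : R) : R :=
  if h is Lower then (a + a') / 2 else a'.

Definition subcell (h : part * part) c : cell R :=
  Cell (part_lo h.1 (xlo c) (xhi c)) (part_hi h.1 (xlo c) (xhi c))
       (part_lo h.2 (ylo c) (yhi c)) (part_hi h.2 (ylo c) (yhi c)).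

Section Hierarchy.
Variables (xs ys : seq R).
(* Theta k is the set of cells subdivided in step k; tau k says how. *)
Variables (Theta : nat -> set (cell R)) (tau : nat -> cell R -> subdivision).

(* The set F_k. *)
Definition fresh (k : nat) : set (cell R) :=
  if k is k'.+1 then
    [set c | exists t h, [/\ Theta k' t, pieces (tau k' t) h & c = subcell h t]]
  else tensor_mesh xs ys.

(* The mesh T_k, as its set of cells. *)
Fixpoint mesh (k : nat) : set (cell R) :=
  if k is k'.+1 then (mesh k' `\` Theta k') `|` fresh k
  else tensor_mesh xs ys.

(* New basis vertices of level k+1. *)
Definition new_basis_vertex (k : nat) v : Prop :=
  basis_vertex (mesh k.+1) v /\ ~ basis_vertex (mesh k) v.

End Hierarchy.

(* C^{al,be}(Om): the partial derivatives D i j (i times in x, j times in y),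
   i <= al, j <= be, exist in the interior and extend continuously to Om. *)
Definition smooth_class (al be : nat) (Om : set (R * R)) f : Prop :=
  exists D : nat -> nat -> R * R -> R,
  [/\ forall p, Om p -> D 0%N 0%N p = f p,
      forall i j, (i <= al)%N -> (j <= be)%N -> {within Om, continuous (D i j)},
      forall i j p, (i < al)%N -> (j <= be)%N -> interior Om p ->
        is_derive p.1 (1 : R) (fun x => D i j (x, p.2)) (D i.+1 j p)
    & forall i j p, (i <= al)%N -> (j < be)%N -> interior Om p ->
        is_derive p.2 (1 : R) (fun y => D i j (p.1, y)) (D i j.+1 p)].

Definition polynomial_on (m n : nat) c s : Prop :=
  exists a : 'M[R]_(m.+1, n.+1), forall p, in_cell c p ->
    s p = \sum_(i < m.+1) \sum_(j < n.+1) a i j * p.1 ^+ i * p.2 ^+ j.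

(* S(m,n,al,be,T).  Only the values on the region matter: values outside it are
   unconstrained, here as in span and independent below. *)
Definition spline_space (m n al be : nat) C : set (R * R -> R) :=
  [set s | smooth_class al be (region C) s
           /\ forall c, C c -> polynomial_on m n c s].

(* Cox-de Boor recursion, with 0/0 = 0.  The basic intervals are half-open
   [t_j, t_{j+1}[, except that the last nonempty one contains its right end, so
   that a B-spline with a quadruple knot on the right takes the value 1 there
   (needed on the right and top sides of the domain). *)
Fixpoint bspline (t : seq R) (d j : nat) (x : R) : R :=
  if d is d'.+1 then
    (x - t`_j) / (t`_(j + d) - t`_j) * bspline t d' j x
    + (t`_(j + d).+1 - x) / (t`_(j + d).+1 - t`_j.+1) * bspline t d' j.+1 x
  else if (t`_j < t`_j.+1)
          && ((t`_j <= x < t`_j.+1) || (x == t`_j.+1) && (x == last 0 t))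
  then 1 else 0.

Definition local_knots (e : bool) (a0 a1 a2 : R) : seq R :=
  if e then [:: a0; a0; a1; a1; a2] else [:: a0; a1; a1; a2; a2].

(* Vanishes outside [sl, sr] x [tl, tr] by construction. *)
Definition vertex_bspline (e1 e2 : bool) (sl sr tl tr : R) v : R * R -> R :=
  fun p => bspline (local_knots e1 sl v.1 sr) 3 0 p.1
           * bspline (local_knots e2 tl v.2 tr) 3 0 p.2.

(* The cells of C around v are exactly the nondegenerate products of
   [sl, v.1], [v.1, sr] with [tl, v.2], [v.2, tr]; a missing side is a
   degenerate interval. *)
Definition vertex_block C v (sl sr tl tr : R) : Prop :=
  [/\ sl <= v.1 <= sr, tl <= v.2 <= tr, exists2 c, C c & in_cell c v
    & forall c, C c /\ in_cell c v <->
        [/\ (xlo c, xhi c) = (sl, v.1) \/ (xlo c, xhi c) = (v.1, sr),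
            (ylo c, yhi c) = (tl, v.2) \/ (ylo c, yhi c) = (v.2, tr),
            xlo c < xhi c & ylo c < yhi c]].

(* The four bicubic B-splines at v. *)
Definition vertex_functions C v : set (R * R -> R) :=
  [set f | exists sl sr tl tr, vertex_block C v sl sr tl tr
           /\ exists e1 e2, f = vertex_bspline e1 e2 sl sr tl tr v].

Definition bernstein3 (i : nat) (t : R) : R := 'C(3, i)%:R * t ^+ i * (1 - t) ^+ (3 - i).

(* Bezier form with ordinates a; the row index runs along x. *)
Definition bezier c (a : 'M[R]_4) p : R :=
  \sum_(i < 4) \sum_(j < 4) a i j
    * bernstein3 i ((p.1 - xlo c) / (xhi c - xlo c))
    * bernstein3 j ((p.2 - ylo c) / (yhi c - ylo c)).

(* The Bezier ordinates of b on c (unique when c is nondegenerate and b is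
   bicubic on c). *)
Definition ordinates b c : 'M[R]_4 :=
  xget 0 [set a | forall p, in_cell c p -> b p = bezier c a p].

(* De Casteljau's scheme at the parameter 1/2. *)
Fixpoint casteljau (a : nat -> R) (r i : nat) : R :=
  if r is r'.+1 then (casteljau a r' i + casteljau a r' i.+1) / 2 else a i.

Definition part_ordinates (h : part) (a : 'I_4 -> R) (i : 'I_4) : R :=
  let d := casteljau (fun k => a (inord k)) in
  match h with Whole => a i | Lower => d i 0%N | Upper => d (3 - i)%N i end.

Definition subcell_ordinates (h : part * part) (a : 'M[R]_4) : 'M[R]_4 :=
  \matrix_(i, j) part_ordinates h.1 (fun i' => part_ordinates h.2 (a i') j) i.

(* The corner of c whose 2 x 2 block contains the ordinate (i, j). *)
Definition ordinate_corner c (i j : nat) : R * R :=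
  (if (i < 2)%N then xlo c else xhi c, if (j < 2)%N then ylo c else yhi c).

Definition zero_at (V : set (R * R)) c (a : 'M[R]_4) : 'M[R]_4 :=
  \matrix_(i, j) if `[< V (ordinate_corner c i j) >] then 0 else a i j.

Definition supp b : set (R * R) := closure [set p | b p != 0].

(* The modification operator for the cells Th, subdivided as told by ty, and
   the set V of new basis vertices.  On an edge shared by several modified
   subcells the value is taken from one of them. *)
Definition modify (Th : set (cell R)) (ty : cell R -> subdivision)
    (V : set (R * R)) b : R * R -> R :=
  fun p => xget (b p)
    [set y | exists t h,
      [/\ Th t, (in_cell t : set (R * R)) `<=` supp b, pieces (ty t) h,
          in_cell (subcell h t) p
        & y = bezier (subcell h t)
                (zero_at V (subcell h t) (subcell_ordinates h (ordinates b t))) p]].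

Section Basis.
Variables (xs ys : seq R).
Variables (Theta : nat -> set (cell R)) (tau : nat -> cell R -> subdivision).
Let T := mesh xs ys Theta tau.
Let F := fresh xs ys Theta tau.
Let new := new_basis_vertex xs ys Theta tau.

(* The set S^k of basis functions of level k. *)
Fixpoint basis (k : nat) : set (R * R -> R) :=
  if k is k'.+1 then
    [set modify (Theta k') (tau k') (new k') b | b in basis k']
    `|` \bigcup_(v in new k') vertex_functions (F k) v
  else \bigcup_(v in vertex (T 0%N)) vertex_functions (T 0%N) v.

End Basis.

(* Linear independence on Om of a (possibly infinite) set of functions. *)
Definition independent (Om : set (R * R)) (S : set (R * R -> R)) : Prop :=
  forall (n : nat) (b : 'I_n -> R * R -> R) (a : 'I_n -> R),
    injective b -> (forall i, S (b i)) ->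
    (forall p, Om p -> \sum_i a i * b i p = 0) -> forall i, a i = 0.

Definition span (Om : set (R * R)) (S : set (R * R -> R)) : set (R * R -> R) :=
  [set s | exists (n : nat) (b : 'I_n -> R * R -> R) (a : 'I_n -> R),
     (forall i, S (b i)) /\ forall p, Om p -> s p = \sum_i a i * b i p].

End Defs.

(* Main.v *)
Require Import Defs.
From mathcomp Require Import ring lra.

Set Implicit Arguments.
Unset Strict Implicit.
Unset Printing Implicit Defensive.

(** Attach to a bicubic polynomial its jet at a point: the value, the two first
    derivatives and the mixed derivative.  A cubic on an interval is determined
    by its values and slopes at both ends, and these can be prescribed.  Hence a
    bicubic on a rectangle is determined by its four corner jets, these can be
    prescribed ([jet_hermite]), and its jets along an edge depend only on the
    jets at the two ends of that edge ([jet_face]).  A function lies in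
    S(3,3,1,1,T) if and only if it is bicubic on every cell and the jets of its
    pieces agree wherever cells meet ([spline_of_jet], [jet_of_spline]).  So a
    spline is the same thing as a field of jets that is bicubic on each cell
    ([jet_spline]), and what is left is linear algebra and the combinatorics of
    the mesh.

    The basis vertices are exactly the points of the domain that are a corner of
    every cell containing them ([basis_vertexP]).  A spline whose jets vanish at
    all of them is zero ([jet_spline_unique]); this takes the place of the
    dimension formula.  Indeed, any other vertex lies strictly inside a side of
    some cell, so its jet is determined by jets at corners of that cell, and
    their coordinates appear at an earlier stage of the dyadic subdivision, which
    makes the recursion end.

    The basis is dual to these jets ([local_basis]): every basis vertex carries
    four functions, whose jets vanish at all other basis vertices and at the
    vertex itself are the products of two vectors spanning the pairs (value,
    slope) in x with two such vectors in y, the two vectors adding up to (1, 0)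
    in either direction.  Linear independence and the spanning property follow by
    comparing jets at basis vertices; the constant 1 has the jet (1, 0) x (1, 0)
    everywhere, so all its coefficients are 1.

    It remains to see that a refinement step preserves this description
    ([local_basis_step]).  As a T-vertex never turns into a crossing vertex, a
    new basis vertex is no vertex of the old mesh.  The cells around it are then
    pieces of subdivided cells, and since dyadic intervals with the same midpoint
    coincide, these pieces form a tensor-product block ([new_vertex_aligned]).
    Therefore the jets of a spline over the old mesh may be changed at will at the
    new basis vertices, and Hermite interpolation of the changed jets on the cells
    of the new mesh is again a spline ([refine_jet_spline]).  The modification
    operator sets these jets to zero, because the four Bezier ordinates next to a
    corner encode the jet there ([modify_value]); the new B-splines arise from the
    zero function by prescribing a single jet ([refine_spike],
    [vertex_bspline_jet]). *)

Section ModifiedPHT.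
Variable R : realType.
Implicit Types (a : 'M[R]_4) (c : cell R) (p v w : R * R) (D : R * R -> 'M[R]_2).

(** * Jets of bicubic polynomials *)

Lemma ord2P (P : 'I_2 -> Prop) : P 0 -> P 1 -> forall i, P i.
Proof.
move=> P0 P1 i; have: i = 0 \/ i = 1; last by case=> ->.
by case: i => [[|[|//]] h]; [left|right]; apply: val_inj.
Qed.

Lemma ord4P (P : 'I_4 -> Prop) :
  P (inord 0) -> P (inord 1) -> P (inord 2) -> P (inord 3) -> forall i, P i.
Proof.
move=> P0 P1 P2 P3 i; rewrite -(inord_val i).
by case: i => [[|[|[|[|//]]]] h].
Qed.

Lemma sum2 (V : nmodType) (F : 'I_2 -> V) : \sum_i F i = F 0 + F 1.
Proof. by rewrite !big_ord_recr big_ord0 /= add0r; congr (F _ + F _); apply: val_inj. Qed.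

Lemma sum4 (V : nmodType) (F : 'I_4 -> V) :
  \sum_i F i = F (inord 0) + F (inord 1) + F (inord 2) + F (inord 3).
Proof.
rewrite 4!big_ord_recr big_ord0 /= add0r.
by congr (F _ + F _ + F _ + F _); apply: val_inj; rewrite /= inordK.
Qed.

(** A cubic is the column of its monomial coefficients; the two rows of [jet1 x]
    evaluate it and its derivative at x. *)
Definition jet1 (x : R) : 'M[R]_(2, 4) :=
  \matrix_(i, k) if i == 0 then x ^+ k else x ^+ k.-1 *+ k.

(** A bicubic is the matrix of its monomial coefficients.  Index 1 stands for one
    differentiation, in x for the row index and in y for the column index. *)
Definition jet a p : 'M[R]_2 := jet1 p.1 *m a *m (jet1 p.2)^T.

Lemma jet_entry a q i j : jet a q i j = \sum_(k < 4) \sum_(l < 4)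
  jet1 q.1 i k * a k l * jet1 q.2 j l.
Proof.
rewrite mxE exchange_big; apply: eq_bigr => l _; rewrite mxE mulr_suml.
by apply: eq_bigr => k _; rewrite [in X in _ * X]mxE.
Qed.

Lemma jet0 p : jet 0 p = 0. Proof. by rewrite /jet mulmx0 mul0mx. Qed.

Lemma jetD a a' p : jet (a + a') p = jet a p + jet a' p.
Proof. by rewrite /jet mulmxDr mulmxDl. Qed.

Lemma jetZ k a p : jet (k *: a) p = k *: jet a p.
Proof. by rewrite /jet -scalemxAr -scalemxAl. Qed.

Lemma jet_outer (u u' : 'cV[R]_4) p : jet (u *m u'^T) p = (jet1 p.1 *m u) *m (jet1 p.2 *m u')^T.
Proof. by rewrite /jet trmx_mul !mulmxA. Qed.

Lemma jet1E n x (u : 'M[R]_(4, n)) j : let u' k := u (inord k) j in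
  ((jet1 x *m u) 0 j = u' 0%N + u' 1%N * x + u' 2%N * x ^+ 2 + u' 3%N * x ^+ 3)
  /\ ((jet1 x *m u) 1 j = u' 1%N + 2 * u' 2%N * x + 3 * u' 3%N * x ^+ 2).
Proof.
by split; rewrite mxE sum4 !mxE !inordK //=; ring.
Qed.

(** The top coefficient is read off from the error of the trapezoidal rule for the
    integral of q, which vanishes for quadratic p. *)
Lemma cubic_eq0 (x0 x1 w0 w1 w2 w3 : R) :
    let p x := w0 + w1 * x + w2 * x ^+ 2 + w3 * x ^+ 3 in
    let q x := w1 + 2 * w2 * x + 3 * w3 * x ^+ 2 in
    x0 != x1 -> p x0 = 0 -> q x0 = 0 -> p x1 = 0 -> q x1 = 0 ->
  [/\ w0 = 0, w1 = 0, w2 = 0 & w3 = 0].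
Proof.
move=> p q x01 p0 q0 p1 q1.
have dx : x1 - x0 != 0 by rewrite subr_eq0 eq_sym.
have z3 : w3 = 0.
  apply: (mulfI (expf_neq0 3 dx)).
  transitivity ((x1 - x0) * (q x1 + q x0) - 2 * (p x1 - p x0)).
    by rewrite /p /q; ring.
  by rewrite p0 q0 p1 q1; ring.
have z2 : w2 = 0.
  have two : (2 : R) != 0 by rewrite pnatr_eq0.
  apply: (mulfI two); apply: (mulfI dx); transitivity (q x1 - q x0).
    by rewrite /q z3; ring.
  by rewrite q0 q1; ring.
have z1 : w1 = 0 by rewrite -q0 /q z2 z3; ring.
by split=> //; rewrite -p0 /p z1 z2 z3; ring.
Qed.

Lemma jet1_inj n (x0 x1 : R) (u u' : 'M[R]_(4, n)) : x0 != x1 ->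
  jet1 x0 *m u = jet1 x0 *m u' -> jet1 x1 *m u = jet1 x1 *m u' -> u = u'.
Proof.
move=> x01 E0 E1; apply/eqP; rewrite -subr_eq0; apply/eqP/matrixP => k j.
have F0 : jet1 x0 *m (u - u') = 0 by rewrite mulmxBr E0 subrr.
have F1 : jet1 x1 *m (u - u') = 0 by rewrite mulmxBr E1 subrr.
rewrite [RHS]mxE; move: (u - u') F0 F1 => {u u' E0 E1} u F0 F1.
have [e0 e0'] := jet1E x0 u j; have [e1 e1'] := jet1E x1 u j.
rewrite F0 !mxE in e0 e0'; rewrite F1 !mxE in e1 e1'.
by move: k; apply: ord4P; case: (cubic_eq0 x01 (esym e0) (esym e0') (esym e1) (esym e1')).
Qed.

(** Coordinate directions are booleans, [true] being y, so that statements about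
    both directions are proved once. *)
Definition coordinate (d : bool) p : R := if d then p.2 else p.1.

Definition set_coordinate (d : bool) (x : R) p : R * R := if d then (p.1, x) else (x, p.2).

Definition side (d : bool) c : R * R := if d then (ylo c, yhi c) else (xlo c, xhi c).

Definition corner_of c (s t : bool) : R * R :=
  (if s then xhi c else xlo c, if t then yhi c else ylo c).

Definition at_end d c w := coordinate d w = (side d c).1 \/ coordinate d w = (side d c).2.

Lemma in_cellP c p :
  in_cell c p <-> forall d, (side d c).1 <= coordinate d p <= (side d c).2.
Proof.
split; first by case/andP=> h1 h2 [].
by move=> h; apply/andP; split; [exact: (h false)|exact: (h true)].
Qed.

Lemma cornerP c v : corner c v <-> forall d, at_end d c v.
Proof. by split=> [[h1 h2] []//|h]; split; [exact: (h false)|exact: (h true)]. Qed.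

Lemma corner_ofP c v : corner c v -> exists s t, v = corner_of c s t.
Proof.
case: v => x y [/= [->|->] [->|->]]; by
  [exists false, false|exists false, true|exists true, false|exists true, true].
Qed.

Lemma at_end_or_inside d c w : in_cell c w ->
  at_end d c w \/ (side d c).1 < coordinate d w < (side d c).2.
Proof.
move=> /in_cellP/(_ d)/andP[h1 h2].
have [e|n1] := eqVneq (coordinate d w) (side d c).1; first by left; left.
have [e|n2] := eqVneq (coordinate d w) (side d c).2; first by left; right.
by right; rewrite !lt_neqAle h1 h2 n2 eq_sym n1.
Qed.

Lemma inside_not_at_end d c v :
  (side d c).1 < coordinate d v < (side d c).2 -> at_end d c v -> False.
Proof. by move=> /andP[h1 h2] [e|e]; move: h1 h2; rewrite e ltxx. Qed.

Lemma corner_in c v : (forall d, (side d c).1 < (side d c).2) -> corner c v -> in_cell c v.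
Proof.
move=> l /cornerP e; apply/in_cellP => d; have := l d.
by case: (e d) => ->; rewrite lexx ?andbT => /ltW.
Qed.

(** Along a line parallel to an axis, the value and the normal derivative, and
    with them the whole jet, are governed by cubics in one variable. *)
Lemma jet_edge d x y a a' w : x != y ->
  jet a (set_coordinate d x w) = jet a' (set_coordinate d x w) ->
  jet a (set_coordinate d y w) = jet a' (set_coordinate d y w) ->
  forall z, jet a (set_coordinate d z w) = jet a' (set_coordinate d z w).
Proof.
rewrite /jet; case: d => /= xy ex ey z.
  rewrite -!mulmxA !(mulmxA (jet1 _)); apply: trmx_inj.
  rewrite !trmx_mul !trmxK; congr (_ *m _); apply: (jet1_inj xy).
    by apply: trmx_inj; rewrite !trmx_mul !trmxK.
  by apply: trmx_inj; rewrite !trmx_mul !trmxK.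
by rewrite -!mulmxA; congr (_ *m _); apply: (jet1_inj xy); rewrite !mulmxA.
Qed.

(** The workhorse for T-vertices.  The corners that are compared are those of the
    smallest face of the rectangle through w: w itself, the two ends of an edge, or
    all four corners. *)
Lemma jet_face c a a' w : in_cell c w ->
  (forall v, corner c v -> (forall d, at_end d c w -> coordinate d v = coordinate d w) ->
     jet a v = jet a' v) ->
  jet a w = jet a' w.
Proof.
move=> cw H.
have Hx x : (x = xlo c \/ x = xhi c) -> (at_end false c w -> x = w.1) ->
    jet a (x, w.2) = jet a' (x, w.2).
  move=> xe xw; have [ye|/andP[/= y0 y1]] := at_end_or_inside true cw.
    by apply: H; [split|case].
  have y01 := lt_trans y0 y1.
  have := @jet_edge true (ylo c) (yhi c) a a' (x, w.2) (negbT (lt_eqF y01)); apply.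
    by apply: H; [split=> //; left|case=> // -[] /= e; move: y0 y1; rewrite e ltxx].
  by apply: H; [split=> //; right|case=> // -[] /= e; move: y0 y1; rewrite e ltxx].
rewrite [w]surjective_pairing.
have [xe|/andP[/= x0 x1]] := at_end_or_inside false cw; first exact: Hx.
have x01 := lt_trans x0 x1.
apply: (@jet_edge false (xlo c) (xhi c) a a' w (negbT (lt_eqF x01))).
  by apply: Hx; [left|case=> /= e; move: x0 x1; rewrite e ltxx].
by apply: Hx; [right|case=> /= e; move: x0 x1; rewrite e ltxx].
Qed.

Lemma jet_corners c a a' p : in_cell c p ->
  (forall v, corner c v -> jet a v = jet a' v) -> jet a p = jet a' p.
Proof. by move=> cp H; apply: (jet_face cp) => v cv _; exact: H. Qed.

Definition hermite_mx (x y : R) : 'M[R]_4 := (col_mx (jet1 x) (jet1 y) : 'M[R]_(2 + 2, 4)).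

Lemma mul_hermite_mx x y n (u : 'M[R]_(4, n)) :
  hermite_mx x y *m u = (col_mx (jet1 x *m u) (jet1 y *m u) : 'M[R]_(2 + 2, n)).
Proof. exact: (@mul_col_mx R 2 2 4 n (jet1 x) (jet1 y) u). Qed.

Lemma hermite_mx_unit x y : x != y -> hermite_mx x y \in unitmx.
Proof.
move=> x01; rewrite -unitmx_tr -row_free_unit -kermx_eq0; apply/eqP.
have K0 : hermite_mx x y *m (kermx (hermite_mx x y)^T)^T = 0.
  by apply: trmx_inj; rewrite trmx_mul trmxK mulmx_ker trmx0.
rewrite mul_hermite_mx in K0.
apply: trmx_inj; apply: (jet1_inj x01); rewrite trmx0 mulmx0.
  by have := congr1 (@usubmx _ 2 2 4) K0; rewrite col_mxKu linear0.
by have := congr1 (@dsubmx _ 2 2 4) K0; rewrite col_mxKd linear0.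
Qed.

Lemma jet1_hermite_mxV x y : x != y ->
  jet1 x *m invmx (hermite_mx x y) = row_mx 1%:M 0 :> 'M[R]_(2, 2 + 2) /\
  jet1 y *m invmx (hermite_mx x y) = row_mx 0 1%:M :> 'M[R]_(2, 2 + 2).
Proof.
move=> xy; have := mulmxV (hermite_mx_unit xy).
rewrite mul_hermite_mx -[X in _ = X]/(1%:M : 'M[R]_(2 + 2)) (@scalar_mx_block _ 2 2).
by rewrite /block_mx => E; apply: (@eq_col_mx R 2 2 4 _ _ _ _ E).
Qed.

(** Hermite interpolation: the bicubic with prescribed jets at the corners of a
    cell. *)
Definition hermite c D : 'M[R]_4 :=
  invmx (hermite_mx (xlo c) (xhi c)) *m
  (block_mx (D (corner_of c false false)) (D (corner_of c false true))
     (D (corner_of c true false)) (D (corner_of c true true)) : 'M[R]_(2 + 2)) *m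
  (invmx (hermite_mx (ylo c) (yhi c)))^T.

Lemma jet_hermite c D s t : xlo c < xhi c -> ylo c < yhi c ->
  jet (hermite c D) (corner_of c s t) = D (corner_of c s t).
Proof.
move=> /lt_eqF/negbT/jet1_hermite_mxV[x0 x1] /lt_eqF/negbT/jet1_hermite_mxV[y0 y1].
rewrite /jet /hermite /=.
set B := block_mx _ _ _ _.
transitivity ((jet1 (corner_of c s t).1 *m invmx (hermite_mx (xlo c) (xhi c)) : 'M[R]_(2, 2 + 2)) *m B
   *m (jet1 (corner_of c s t).2 *m invmx (hermite_mx (ylo c) (yhi c)) : 'M[R]_(2, 2 + 2))^T).
  by rewrite trmx_mul !mulmxA.
rewrite /B; case: s; case: t => /=; rewrite ?x0 ?x1 ?y0 ?y1 tr_row_mx mul_row_block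
   !trmx0 !trmx1 ?mul1mx ?mul0mx ?addr0 ?add0r mul_row_col ?mulmx1 ?mulmx0 ?addr0 ?add0r //.
Qed.

(** Finite differences over four equidistant points recover the coefficients, the
    highest one first. *)
Lemma cubic_itv_eq0 (x0 x1 w0 w1 w2 w3 : R) :
    let p x := w0 + w1 * x + w2 * x ^+ 2 + w3 * x ^+ 3 in
    x0 < x1 -> (forall x, x0 <= x <= x1 -> p x = 0) ->
  [/\ w0 = 0, w1 = 0, w2 = 0 & w3 = 0].
Proof.
move=> p x01 p0; set h := (x1 - x0) / 3.
have h0 : 0 < h by rewrite divr_gt0 // subr_gt0.
have pk k : (k <= 3)%N -> p (x0 + h *+ k) = 0.
  move=> k3; apply: p0; rewrite lerDl mulrn_wge0 ?(ltW h0) //=.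
  rewrite (_ : x1 = x0 + h *+ 3); last by rewrite /h -mulr_natr; field.
  by rewrite lerD2l ler_pMn2l.
have hn n : h ^+ n != 0 by rewrite expf_neq0 // gt_eqF.
have nz n : (n.+1%:R : R) != 0 by rewrite pnatr_eq0.
have z3 : w3 = 0.
  apply: (mulfI (hn 3)); apply: (mulfI (nz 5)).
  (* The third difference of p with step h is 6 w3 h^3. *)
  transitivity (p (x0 + h *+ 3) - 3 * p (x0 + h *+ 2) + 3 * p (x0 + h *+ 1) - p (x0 + h *+ 0)).
    by rewrite /p; ring.
  by rewrite !pk //; ring.
have z2 : w2 = 0.
  apply: (mulfI (hn 2)); apply: (mulfI (nz 1)).
  transitivity (p (x0 + h *+ 2) - 2 * p (x0 + h *+ 1) + p (x0 + h *+ 0)).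
    by rewrite /p z3; ring.
  by rewrite !pk //; ring.
have z1 : w1 = 0.
  apply: (mulfI (hn 1)).
  transitivity (p (x0 + h *+ 1) - p (x0 + h *+ 0)).
    by rewrite /p z3 z2; ring.
  by rewrite !pk //; ring.
by split=> //; rewrite -(pk 0%N) // /p z1 z2 z3; ring.
Qed.

Lemma jet1_itv_eq0 (x0 x1 : R) (u : 'cV[R]_4) : x0 < x1 ->
  (forall x, x0 <= x <= x1 -> (jet1 x *m u) 0 0 = 0) -> u = 0.
Proof.
move=> x01 u0.
have [|z0 z1 z2 z3] := cubic_itv_eq0 (x0 := x0) (x1 := x1) (w0 := u (inord 0) 0)
   (w1 := u (inord 1) 0) (w2 := u (inord 2) 0) (w3 := u (inord 3) 0) x01.
  by move=> x xx; have [<- _] := jet1E x u 0; exact: u0.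
by apply/matrixP => i j; rewrite ord1 [RHS]mxE; move: i; apply: ord4P.
Qed.

Definition bicubic a p : R := jet a p 0 0.

Lemma bicubicE a p : bicubic a p = \sum_(i < 4) \sum_(j < 4) a i j * p.1 ^+ i * p.2 ^+ j.
Proof.
rewrite /bicubic mxE exchange_big; apply: eq_bigr => j _ /=.
rewrite !mxE /= mulr_suml; apply: eq_bigr => i _.
by rewrite !mxE /=; ring.
Qed.

Lemma bicubic_eq0 c a : xlo c < xhi c -> ylo c < yhi c ->
  (forall p, in_cell c p -> bicubic a p = 0) -> a = 0.
Proof.
move=> cx cy H; apply/matrixP => i j; rewrite [RHS]mxE.
have H1 y : ylo c <= y <= yhi c -> a *m col 0 (jet1 y)^T = 0.
  move=> yy; apply: (jet1_itv_eq0 cx) => x xx.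
  have := H (x, y); rewrite /in_cell /= xx yy => /(_ isT).
  rewrite mulmxA => <-; rewrite /bicubic /jet 2!mxE.
  by apply: eq_bigr => k _; rewrite !mxE.
suff: (row i a)^T = 0 by move/matrixP/(_ j 0); rewrite !mxE.
apply: (jet1_itv_eq0 cy) => y yy.
have := H1 y yy => /matrixP/(_ i 0); rewrite !mxE => E.
by rewrite -[RHS]E; apply: eq_bigr => k _; rewrite !mxE mulrC.
Qed.

Lemma bicubic_inj c a a' : (forall d, (side d c).1 < (side d c).2) ->
  (forall p, in_cell c p -> bicubic a p = bicubic a' p) -> a = a'.
Proof.
move=> l H; apply/eqP; rewrite -subr_eq0; apply/eqP.
apply: (bicubic_eq0 (l false) (l true)) => p cp; have := H p cp; rewrite /bicubic => e.
by rewrite -scaleN1r jetD jetZ mxE [X in _ + X]mxE e mulN1r subrr.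
Qed.

(** * Bernstein polynomials, corner jets and the de Casteljau scheme *)

Lemma bin32 : 'C(3, 2) = 3%N. Proof. by []. Qed.

(** The columns are the monomial coefficients of the cubic Bernstein polynomials
    of the interval [lo, hi]. *)
Definition bernstein_mx (lo hi : R) : 'M[R]_4 := \matrix_(k, i)
  (nth 0 (nth [::]
    [:: [:: hi ^+ 3; - 3 * hi ^+ 2; 3 * hi; -1];
        [:: - 3 * (lo * hi ^+ 2); 3 * (hi ^+ 2 + 2 * lo * hi);
            - 3 * (2 * hi + lo); 3];
        [:: 3 * (lo ^+ 2 * hi); - 3 * (2 * lo * hi + lo ^+ 2);
            3 * (hi + 2 * lo); - 3];
        [:: - lo ^+ 3; 3 * lo ^+ 2; - 3 * lo; 1]] i) k / (hi - lo) ^+ 3).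

Lemma bernstein_mx_val lo hi x i : lo < hi ->
  (jet1 x *m bernstein_mx lo hi) 0 i = bernstein3 i ((x - lo) / (hi - lo)).
Proof.
move=> lh; have h0 : hi - lo != 0 by rewrite subr_eq0 gt_eqF.
have [-> _] := jet1E x (bernstein_mx lo hi) i; move: i; apply: ord4P;
  rewrite !mxE !inordK // /bernstein3 /= (bin0, bin1, binn, bin32) ?subn0 ?subnn ?expr0; by field.
Qed.

(** At an end of the interval, value and slope involve the two nearest ordinates
    only. *)
Lemma bernstein_mx_lo lo hi (n : nat) (u : 'M[R]_(4, n)) j : lo < hi ->
  (jet1 lo *m (bernstein_mx lo hi *m u)) 0 j = u (inord 0) j /\
  (jet1 lo *m (bernstein_mx lo hi *m u)) 1 j =
     3 / (hi - lo) * (u (inord 1) j - u (inord 0) j).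
Proof.
move=> lh; have h0 : hi - lo != 0 by rewrite subr_eq0 gt_eqF.
have [-> ->] := jet1E lo (bernstein_mx lo hi *m u) j.
by split; rewrite !mxE !sum4 !mxE !inordK //=; field.
Qed.

Lemma bernstein_mx_hi lo hi (n : nat) (u : 'M[R]_(4, n)) j : lo < hi ->
  (jet1 hi *m (bernstein_mx lo hi *m u)) 0 j = u (inord 3) j /\
  (jet1 hi *m (bernstein_mx lo hi *m u)) 1 j =
     3 / (hi - lo) * (u (inord 3) j - u (inord 2) j).
Proof.
move=> lh; have h0 : hi - lo != 0 by rewrite subr_eq0 gt_eqF.
have [-> ->] := jet1E hi (bernstein_mx lo hi *m u) j.
by split; rewrite !mxE !sum4 !mxE !inordK //=; field.
Qed.

Lemma bernstein_mx_unit lo hi : lo < hi -> bernstein_mx lo hi \in unitmx.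
Proof.
move=> lh; have h0 : hi - lo != 0 by rewrite subr_eq0 gt_eqF.
rewrite -unitmx_tr -row_free_unit -kermx_eq0; apply/eqP.
apply: trmx_inj; have: bernstein_mx lo hi *m (kermx (bernstein_mx lo hi)^T)^T = 0.
  by apply: trmx_inj; rewrite trmx_mul trmxK mulmx_ker trmx0.
move: (_^T) => u u0; rewrite trmx0; apply/matrixP => i j; rewrite [RHS]mxE; move: i.
have n0 : 3 / (hi - lo) != 0 by rewrite mulf_neq0 ?invr_eq0 ?pnatr_eq0.
have [] := bernstein_mx_lo u j lh; have [] := bernstein_mx_hi u j lh; rewrite u0 !mulmx0 !mxE.
move=> /esym u3 /esym/eqP; rewrite u3 mulf_eq0 (negPf n0) sub0r oppr_eq0 => /eqP u2.
move=> /esym z /esym/eqP; rewrite z mulf_eq0 (negPf n0) subr0 => /eqP u1.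
exact: ord4P.
Qed.

Definition bezier_coef c a : 'M[R]_4 :=
  bernstein_mx (xlo c) (xhi c) *m a *m (bernstein_mx (ylo c) (yhi c))^T.

Lemma bezier_bicubic c a p : xlo c < xhi c -> ylo c < yhi c ->
  bezier c a p = bicubic (bezier_coef c a) p.
Proof.
move=> cx cy; rewrite /bicubic /bezier_coef /jet.
have -> : jet1 p.1 *m (bernstein_mx (xlo c) (xhi c) *m a *m (bernstein_mx (ylo c) (yhi c))^T)
   *m (jet1 p.2)^T = (jet1 p.1 *m bernstein_mx (xlo c) (xhi c)) *m a *m
      (jet1 p.2 *m bernstein_mx (ylo c) (yhi c))^T by rewrite trmx_mul !mulmxA.
rewrite mxE /bezier exchange_big; apply: eq_bigr => j _ /=.
rewrite !mxE mulr_suml; apply: eq_bigr => i _.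
have := bernstein_mx_val p.2 j cy; rewrite mxE => ->; have := bernstein_mx_val p.1 i cx => ->.
by rewrite (mulrC (a i j)).
Qed.

Lemma bezier_exists c A : xlo c < xhi c -> ylo c < yhi c ->
  exists a, bezier_coef c a = A.
Proof.
move=> cx cy; exists (invmx (bernstein_mx (xlo c) (xhi c)) *m A *m (invmx (bernstein_mx (ylo c) (yhi c)))^T).
rewrite /bezier_coef !mulmxA mulmxV ?bernstein_mx_unit // mul1mx -mulmxA -trmx_mul.
by rewrite mulmxV ?bernstein_mx_unit // trmx1 mulmx1.
Qed.

Lemma ordinatesP b c a : xlo c < xhi c -> ylo c < yhi c ->
  (forall p, in_cell c p -> b p = bicubic a p) ->
  forall p, in_cell c p -> b p = bezier c (ordinates b c) p.
Proof.
move=> cx cy H; rewrite /ordinates; case: xgetP => [z _ zP|no]; first exact: zP.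
have [z ez] := bezier_exists a cx cy; exfalso; apply: (no z) => p cp.
by rewrite bezier_bicubic // ez H.
Qed.

(** The ordinates with index at least 2 belong to the upper end, the others to the
    lower end. *)
Lemma jet1_bernstein_end (s : bool) lo hi n (u u' : 'M[R]_(4, n)) : lo < hi ->
  (forall k : 'I_4, (2 <= k)%N = s -> row k u = row k u') ->
  jet1 (if s then hi else lo) *m (bernstein_mx lo hi *m u) =
  jet1 (if s then hi else lo) *m (bernstein_mx lo hi *m u').
Proof.
move=> lh E; apply/matrixP => r j.
have Ek k : (k < 4)%N -> (2 <= k)%N = s -> u (inord k) j = u' (inord k) j.
  move=> k4 ks; have /(_ _)/matrixP/(_ 0 j) := E (inord k).
  by rewrite inordK // => /(_ ks); rewrite !mxE.
move: r; case: s E Ek => E Ek; apply: ord2P.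
- by have [-> _] := bernstein_mx_hi u j lh; have [-> _] := bernstein_mx_hi u' j lh; rewrite Ek.
- by have [_ ->] := bernstein_mx_hi u j lh; have [_ ->] := bernstein_mx_hi u' j lh; rewrite !Ek.
- by have [-> _] := bernstein_mx_lo u j lh; have [-> _] := bernstein_mx_lo u' j lh; rewrite Ek.
- by have [_ ->] := bernstein_mx_lo u j lh; have [_ ->] := bernstein_mx_lo u' j lh; rewrite !Ek.
Qed.

Lemma jet_bezier_corner c s t a a' : xlo c < xhi c -> ylo c < yhi c ->
  (forall i j : 'I_4, (2 <= i)%N = s -> (2 <= j)%N = t -> a i j = a' i j) ->
  jet (bezier_coef c a) (corner_of c s t) = jet (bezier_coef c a') (corner_of c s t).
Proof.
move=> cx cy E; rewrite /jet /bezier_coef.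
have e b : jet1 (corner_of c s t).1 *m (bernstein_mx (xlo c) (xhi c) *m b *m
    (bernstein_mx (ylo c) (yhi c))^T) *m (jet1 (corner_of c s t).2)^T =
  jet1 (corner_of c s t).1 *m (bernstein_mx (xlo c) (xhi c) *m (b *m
    (jet1 (corner_of c s t).2 *m bernstein_mx (ylo c) (yhi c))^T)).
  by rewrite trmx_mul !mulmxA.
rewrite !e; apply: jet1_bernstein_end => // i si.
rewrite !row_mul -[LHS]trmxK -[RHS]trmxK; congr (_^T); rewrite !trmx_mul !trmxK -!mulmxA.
apply: jet1_bernstein_end => // j tj; apply/matrixP => z k; rewrite !mxE.
exact: E.
Qed.

(** The jet at a corner depends on the 2 x 2 block of ordinates associated with
    that corner alone, so erasing the blocks at the points of V erases exactly the
    jets there. *)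
Lemma jet_zero_at V c s t a : xlo c < xhi c -> ylo c < yhi c ->
  jet (bezier_coef c (zero_at V c a)) (corner_of c s t) =
  if `[< V (corner_of c s t) >] then 0 else jet (bezier_coef c a) (corner_of c s t).
Proof.
move=> cx cy; have oc (i j : 'I_4) : (2 <= i)%N = s -> (2 <= j)%N = t ->
    ordinate_corner c i j = corner_of c s t.
  by move=> <- <-; rewrite /ordinate_corner /corner_of (ltnNge i 2) (ltnNge j 2);
    case: (2 <= i)%N; case: (2 <= j)%N.
case: asboolP => v; last first.
  by apply: jet_bezier_corner => // i j si tj; rewrite mxE oc // asboolF.
transitivity (jet (bezier_coef c 0) (corner_of c s t)); last first.
  by rewrite /bezier_coef /jet !(mulmx0, mul0mx).
by apply: jet_bezier_corner => // i j si tj; rewrite !mxE oc // asboolT.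
Qed.

Definition bezier1 (lo hi : R) (a : 'I_4 -> R) x :=
  \sum_i a i * bernstein3 i ((x - lo) / (hi - lo)).

(** Subdivision of an interval at its midpoint does not change the cubic. *)
Lemma casteljau_part h lo hi (a : 'I_4 -> R) x : lo < hi ->
  bezier1 (part_lo h lo hi) (part_hi h lo hi) (part_ordinates h a) x = bezier1 lo hi a x.
Proof.
move=> lh; have h0 : hi - lo != 0 by rewrite subr_eq0 gt_eqF.
rewrite /bezier1 !sum4 /bernstein3 !inordK // bin0 bin1 bin32 binn.
by case: h => //; rewrite /part_ordinates /part_lo /part_hi !inordK //=; field.
Qed.

Lemma bezier_subcell h c a p : xlo c < xhi c -> ylo c < yhi c ->
  bezier (subcell h c) (subcell_ordinates h a) p = bezier c a p.
Proof.
move=> cx cy.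
have E c' a' : bezier c' a' p = bezier1 (ylo c') (yhi c')
    (fun j => bezier1 (xlo c') (xhi c') (a' ^~ j) p.1) p.2.
  rewrite /bezier exchange_big; apply: eq_bigr => j _; rewrite mulr_suml.
  exact: eq_bigr.
have E' c' a' : bezier c' a' p = bezier1 (xlo c') (xhi c')
    (fun i => bezier1 (ylo c') (yhi c') (a' i) p.2) p.1.
  apply: eq_bigr => i _; rewrite mulr_suml; apply: eq_bigr => j _.
  exact: mulrAC.
transitivity (bezier1 (part_lo h.2 (ylo c) (yhi c)) (part_hi h.2 (ylo c) (yhi c))
    (fun j => bezier1 (xlo c) (xhi c) (fun i => part_ordinates h.2 (a i) j) p.1) p.2).
  rewrite E; apply: eq_bigr => j _; congr (_ * _).
  rewrite -(casteljau_part h.1 _ _ cx); apply: eq_bigr => i _; congr (_ * _).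
  by rewrite mxE.
have := E' (Cell (xlo c) (xhi c) (part_lo h.2 (ylo c) (yhi c)) (part_hi h.2 (ylo c) (yhi c)))
  (\matrix_(i, j) part_ordinates h.2 (a i) j).
rewrite E /= => Q; transitivity (bezier1 (part_lo h.2 (ylo c) (yhi c)) (part_hi h.2 (ylo c) (yhi c))
    (fun j => bezier1 (xlo c) (xhi c) ((\matrix_(i, j) part_ordinates h.2 (a i) j)^~ j) p.1) p.2).
  apply: eq_bigr => j _; congr (_ * _); apply: eq_bigr => i _; by rewrite mxE.
rewrite Q E'; apply: eq_bigr => i _; congr (_ * _).
rewrite -(casteljau_part h.2 _ _ cy); apply: eq_bigr => j _; by rewrite mxE.
Qed.

(** * Cubic B-splines with double knots *)

(** Value and slope, at the middle knot a1, of the cubic B-spline with these local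
    knots. *)
Definition knot_jet (e : bool) (a0 a1 a2 : R) : 'cV[R]_2 :=
  \col_i if e then (if i == 0 then (a2 - a1) / (a2 - a0) else - 3 / (a2 - a0))
  else (if i == 0 then (a1 - a0) / (a2 - a0) else 3 / (a2 - a0)).

Definition col4 (b0 b1 b2 b3 : R) : 'cV[R]_4 := \col_i nth 0 [:: b0; b1; b2; b3] i.

Lemma col4E b0 b1 b2 b3 : ((col4 b0 b1 b2 b3 (inord 0) 0 = b0) *
  (col4 b0 b1 b2 b3 (inord 1) 0 = b1) * (col4 b0 b1 b2 b3 (inord 2) 0 = b2) *
  (col4 b0 b1 b2 b3 (inord 3) 0 = b3))%type.
Proof. by rewrite !mxE !inordK. Qed.

Lemma bernstein_mx_col4 lo hi b0 b1 b2 b3 x : lo < hi ->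
  let t := (x - lo) / (hi - lo) in
  (jet1 x *m (bernstein_mx lo hi *m col4 b0 b1 b2 b3)) 0 0 =
  b0 * (1 - t) ^+ 3 + 3 * b1 * t * (1 - t) ^+ 2 + 3 * b2 * t ^+ 2 * (1 - t) + b3 * t ^+ 3.
Proof.
move=> lh t; rewrite mulmxA mxE sum4 !bernstein_mx_val // /bernstein3 !inordK // -/t !mxE !inordK //=.
by rewrite bin0 bin1 bin32 binn; ring.
Qed.

(** All basic intervals lie between the first and the last knot. *)
Lemma bspline_out e (a0 a1 a2 : R) x : a0 <= a1 <= a2 -> x < a0 \/ a2 < x ->
  bspline (local_knots e a0 a1 a2) 3 0 x = 0.
Proof.
move=> /andP[a01 a12] xo.
have z t j : all (fun y => a0 <= y <= a2) t -> (j.+1 < size t)%N -> bspline t 0 j x = 0.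
  move=> /allP h jt.
  have /andP[l1 u1] := h _ (mem_nth 0 (ltnW jt)); have /andP[l2 u2] := h _ (mem_nth 0 jt).
  rewrite /=; case: ifP => // /andP[_ /orP[/andP[p q]|/andP[/eqP q _]]].
    by case: xo => xo; [move: (lt_le_trans xo l1); rewrite ltNge p
      |move: (lt_le_trans q u2); rewrite ltNge (ltW xo)].
  by case: xo => xo; rewrite q ltNge ?l2 ?u2 in xo.
have {}z j : (j < 4)%N -> bspline (local_knots e a0 a1 a2) 0 j x = 0.
  have a02 := le_trans a01 a12.
  by move=> j4; apply: z; case: e => //=; rewrite ?lexx ?a01 ?a12 ?a02.
have := z 0%N; have := z 1%N; have := z 2%N; have := z 3%N.
rewrite /bspline -/(bspline _ 0).
by do 4![move=> -> //]; rewrite !(mulr0, addr0).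
Qed.

(** On one knot interval the B-spline is a cubic, and its outer knots have
    multiplicity at most two, so it vanishes at the outer end together with its
    slope. *)
Lemma bspline_left e (a0 a1 a2 : R) : a0 < a1 -> a1 <= a2 -> exists u : 'cV[R]_4,
  [/\ forall x, a0 <= x <= a1 ->
        bspline (local_knots e a0 a1 a2) 3 0 x = (jet1 x *m u) 0 0,
      jet1 a0 *m u = 0 & jet1 a1 *m u = knot_jet e a0 a1 a2].
Proof.
move=> a01 a12; have a02 := lt_le_trans a01 a12.
have n01 : a1 - a0 != 0 by rewrite subr_eq0 gt_eqF.
have n02 : a2 - a0 != 0 by rewrite subr_eq0 gt_eqF.
pose v := knot_jet e a0 a1 a2 0 0; pose s := knot_jet e a0 a1 a2 1 0.
(* Bezier ordinates of the cubic with end data (0, 0) and (v, s). *)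
exists (bernstein_mx a0 a1 *m col4 0 0 (v - s * (a1 - a0) / 3) v); split; first last.
- apply/matrixP => i j; rewrite ord1; move: i j => i _; move: i.
  have [e0 e1] := bernstein_mx_hi (col4 0 0 (v - s * (a1 - a0) / 3) v) 0 a01.
  apply: ord2P; rewrite ?e0 ?e1 !col4E /v /s !mxE //=.
  by case: (e); field; rewrite ?n01 ?n02 //.
- apply/matrixP => i j; rewrite ord1; move: i j => i _; move: i.
  have [e0 e1] := bernstein_mx_lo (col4 0 0 (v - s * (a1 - a0) / 3) v) 0 a01.
  by apply: ord2P; rewrite ?e0 ?e1 !col4E !mxE ?subrr ?mulr0.
move=> x /andP[x0 x1]; rewrite bernstein_mx_col4 // /v /s !mxE {v s} /=.
have [x1'|x1'] := ltP x a1.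
  have xa1 := lt_eqF x1'; have x2 := lt_le_trans x1' a12; have xa2 := lt_eqF x2.
  have nx1 := lt_geF x1'; have nx2 := lt_geF x2.
  case: e; rewrite /= !ltxx a01 x0 x1' x2 xa1 ?xa2 ?nx1 ?nx2 /= ?andbF ?orbF /=
     ?(mulr0, add0r, addr0, mulr1); field; rewrite ?n01 ?n02 //.
have {x1 x1'} -> : x = a1 by apply/eqP; rewrite eq_le x1.
move: a12; rewrite le_eqVlt => /orP[/eqP a12|a12].
  rewrite -a12 /= in n02 a02 *.
  by case: e; rewrite /= !ltxx a01 (ltW a01) ?eqxx /= ?andbF ?orbF /= ?(mulr0, mul0r, add0r,
    addr0, mulr1, subrr);
     field; rewrite ?n01 //.
have n12 : a2 - a1 != 0 by rewrite subr_eq0 gt_eqF.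
have a12' := ltW a12; have na12 := lt_eqF a12.
by case: e; rewrite /= !ltxx a01 a12 (ltW a01) ?eqxx ?lexx ?na12 /= ?andbF ?orbF /= ?(mulr0,
  mul0r, add0r, addr0, mulr1, subrr);
     field; rewrite ?n01 ?n02 ?n12 //.
Qed.

Lemma bspline_right e (a0 a1 a2 : R) : a0 <= a1 -> a1 < a2 -> exists u : 'cV[R]_4,
  [/\ forall x, a1 <= x <= a2 ->
        bspline (local_knots e a0 a1 a2) 3 0 x = (jet1 x *m u) 0 0,
      jet1 a1 *m u = knot_jet e a0 a1 a2 & jet1 a2 *m u = 0].
Proof.
move=> a01 a12; have a02 := le_lt_trans a01 a12.
have n12 : a2 - a1 != 0 by rewrite subr_eq0 gt_eqF.
have n02 : a2 - a0 != 0 by rewrite subr_eq0 gt_eqF.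
pose v := knot_jet e a0 a1 a2 0 0; pose s := knot_jet e a0 a1 a2 1 0.
(* Bezier ordinates of the cubic with end data (v, s) and (0, 0). *)
exists (bernstein_mx a1 a2 *m col4 v (v + s * (a2 - a1) / 3) 0 0); split; first last.
- apply/matrixP => i j; rewrite ord1; move: i j => i _; move: i.
  have [e0 e1] := bernstein_mx_hi (col4 v (v + s * (a2 - a1) / 3) 0 0) 0 a12.
  by apply: ord2P; rewrite ?e0 ?e1 !col4E !mxE ?subrr ?mulr0.
- apply/matrixP => i j; rewrite ord1; move: i j => i _; move: i.
  have [e0 e1] := bernstein_mx_lo (col4 v (v + s * (a2 - a1) / 3) 0 0) 0 a12.
  apply: ord2P; rewrite ?e0 ?e1 !col4E /v /s !mxE //=.
  by case: (e); field; rewrite ?n12 ?n02 //.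
move=> x /andP[x1 x2]; rewrite bernstein_mx_col4 // /v /s !mxE {v s} /=.
have nx1 := le_gtF x1.
have x0 := le_trans a01 x1.
have [x2'|x2'] := ltP x a2.
  have xa2 := lt_eqF x2'.
  have q (A : bool) : (x == a1) && A = false -> A && (x == a1) = false by rewrite andbC.
  case: e; rewrite /= !ltxx a12 x0 x1 x2' nx1 xa2 ?andbF ?orbF /= ?andbF
     ?(mulr0, add0r, addr0, mulr1); field; rewrite ?n12 ?n02 //.
have {x2 x2' x1 x0 nx1} -> : x = a2 by apply/eqP; rewrite eq_le x2.
have na := lt_gtF a12; have na' := gt_eqF a12; have nb := lt_geF a12.
by case: e; rewrite /= !ltxx a12 (ltW a12) ?eqxx ?na ?na' ?lexx /= ?andbF ?orbF /= ?(mulr0,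
  mul0r, add0r, addr0, mulr1, subrr);
     field; rewrite ?n12 //.
Qed.

(** A B-spline is nonzero at an outermost knot only if this knot is also the
    middle one, that is, if the side is missing. *)
Lemma bspline_supp e (a0 a1 a2 : R) x : a0 <= a1 <= a2 -> a0 < a2 ->
  bspline (local_knots e a0 a1 a2) 3 0 x != 0 ->
  [/\ a0 <= x <= a2, x = a0 -> a0 = a1 & x = a2 -> a1 = a2].
Proof.
move=> a012 a02 nz; have /andP[a01 a12] := a012; split.
- apply/negPn/negP => /negP h; move/eqP: nz; apply; apply: bspline_out => //.
  have [h0|] := ltP x a0; first by left.
  by have [h1|] := ltP a2 x; [right|move=> h1 h0; rewrite h0 h1 in h].
- move=> xa; subst x; apply/eqP; rewrite eq_le a01 leNgt; apply/negP => a01'.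
  have [u [E u0 _]] := bspline_left e a01' a12.
  by rewrite E ?lexx // u0 mxE eqxx in nz.
move=> xa; subst x; apply/eqP; rewrite eq_le a12 leNgt; apply/negP => a12'.
have [u [E _ u0]] := bspline_right e a01 a12'.
by rewrite E ?lexx ?andbT // u0 mxE eqxx in nz.
Qed.

(** Two pairs (value, slope) with sum (1, 0) and nonzero slopes: a basis of R^2 in
    which the jet of the constant 1 has both coordinates 1. *)
Definition unit_pair (a : bool -> 'cV[R]_2) :=
  a true + a false = delta_mx 0 0 /\ a true 1 0 != 0.

Lemma unit_pair_knot_jet (a0 a1 a2 : R) : a0 < a2 ->
  unit_pair (fun e => knot_jet e a0 a1 a2).
Proof.
move=> a02; have n02 : a2 - a0 != 0 by rewrite subr_eq0 gt_eqF.
split; last by rewrite !mxE /= mulf_neq0 ?invr_eq0 ?oppr_eq0 ?pnatr_eq0.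
apply/matrixP => i j; rewrite ord1; move: i j => i _; move: i.
by apply: ord2P; rewrite !mxE /=; field.
Qed.

Lemma unit_pair_false (a : bool -> 'cV[R]_2) : unit_pair a ->
  ((a false 0 0 = 1 - a true 0 0) * (a false 1 0 = - a true 1 0))%type.
Proof.
case=> /matrixP s _; move: (s 0 0) (s 1 0); rewrite !mxE /= ?mulr1n => <- /eqP.
by rewrite addrC addr_eq0 => /eqP ->; rewrite addrAC subrr add0r.
Qed.

(** The coordinate functionals of the basis formed by the two pairs; the formulas
    come from inverting this 2 x 2 matrix. *)
Definition dual_row (a : bool -> 'cV[R]_2) (e : bool) : 'rV[R]_2 :=
  \row_i if e then (if i == 0 then 1 else (1 - a true 0 0) / a true 1 0)
         else (if i == 0 then 1 else - a true 0 0 / a true 1 0).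

Lemma dual_rowK (a : bool -> 'cV[R]_2) e e' : unit_pair a -> dual_row a e *m a e' = (e == e')%:R%:M.
Proof.
move=> ha; have [_ n] := ha; apply/matrixP => i j; rewrite !ord1 !mxE sum2 !mxE /=.
by case: e; case: e'; rewrite ?(unit_pair_false ha) /=; field.
Qed.

Lemma dual_row_unit (a : bool -> 'cV[R]_2) e : unit_pair a -> dual_row a e *m delta_mx 0 0 = 1%:M.
Proof.
move=> ha; have [_ n] := ha; apply/matrixP => i j; rewrite !ord1 !mxE sum2 !mxE /=.
by case: e; rewrite /=; ring.
Qed.

Lemma dual_row_total (a : bool -> 'cV[R]_2) : unit_pair a ->
  a true *m dual_row a true + a false *m dual_row a false = 1%:M.
Proof.
move=> ha; have [_ n] := ha; apply/matrixP => i j; move: i j.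
apply: ord2P; apply: ord2P; rewrite !mxE !big_ord_recl !big_ord0 !mxE /= ?(unit_pair_false ha);
  by field.
Qed.

(** * Dyadic subintervals of a grid *)

Definition part_interval (h : part) (I : R * R) : R * R := (part_lo h I.1 I.2, part_hi h I.1 I.2).

Definition half_interval (b : bool) (I : R * R) : R * R :=
  part_interval (if b then Upper else Lower) I.

(** The successive halves are listed from the coarsest to the finest, so that
    intervals are compared by running through their lists from the head. *)
Definition bisect (I : R * R) (l : seq bool) : R * R := foldl (fun I b => half_interval b I) I l.

Definition subinterval (I K : R * R) : Prop := K.1 <= I.1 /\ I.2 <= K.2.

Definition midpoint (I : R * R) : R := (I.1 + I.2) / 2.

Lemma midpoint_inside (I : R * R) : I.1 < I.2 -> I.1 < midpoint I < I.2.
Proof. by move=> h; rewrite !midf_lt. Qed.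

Lemma half_interval_sub b (I : R * R) : I.1 < I.2 ->
  subinterval (half_interval b I) I /\ (half_interval b I).1 < (half_interval b I).2.
Proof.
move=> h; have /andP[h1 h2] := midpoint_inside h.
by case: b; rewrite /subinterval /half_interval /part_interval /=; do ?split=> //;
  rewrite ?lexx //; apply: ltW.
Qed.

Lemma part_interval_Whole (I : R * R) : part_interval Whole I = I. Proof. by case: I. Qed.

Lemma part_interval_sub q (I : R * R) : I.1 < I.2 ->
  subinterval (part_interval q I) I /\ (part_interval q I).1 < (part_interval q I).2.
Proof.
move=> h; case: q; last 2 first.
- exact: (half_interval_sub false h).
- exact: (half_interval_sub true h).
by rewrite /subinterval /= !lexx.
Qed.

Lemma bisect_sub l (I : R * R) : I.1 < I.2 ->
  subinterval (bisect I l) I /\ (bisect I l).1 < (bisect I l).2.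
Proof.
elim: l I => [|b l IH] I h; first by rewrite /subinterval /= !lexx.
have [[s1 s2] /IH [[s3 s4] s5]] := half_interval_sub b h.
by rewrite /subinterval in s3 s4 *; split => //; split; [exact: le_trans s3|exact: le_trans s2].
Qed.

(** The alternatives for dyadic intervals of depths n and m.  That a strictly
    smaller interval stays within one half of the larger one is what makes the
    midpoint of the larger one a knot. *)
Definition nested n m (I K : R * R) : Prop :=
  [\/ I.2 <= K.1 \/ K.2 <= I.1, I = K,
     (m < n)%N /\ exists b, subinterval I (half_interval b K)
   | (n < m)%N /\ exists b, subinterval K (half_interval b I)].

(** The first difference of the two lists separates the intervals.  If one list is
    a prefix of the other, the next entry of the longer one names the half. *)
Lemma bisect_nested (I : R * R) l l' : I.1 < I.2 ->
  nested (size l) (size l') (bisect I l) (bisect I l').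
Proof.
elim: l l' I => [|b l IH] [|b' l'] I h.
- by constructor 2.
- by constructor 4; split=> //; exists b'; have [_ /(bisect_sub l')[]] := half_interval_sub b' h.
- by constructor 3; split=> //; exists b; have [_ /(bisect_sub l)[]] := half_interval_sub b h.
have [<-|ne] := eqVneq b b'; first by have [_ /IH] := half_interval_sub b h; apply.
constructor 1; have [_ /(bisect_sub l)[[s1 s2] _]] := half_interval_sub b h.
have [_ /(bisect_sub l')[[s3 s4] _]] := half_interval_sub b' h.
case: b b' ne s1 s2 s3 s4 => [] [] //= _ s1 s2 s3 s4.
  by right; exact: le_trans s4 s1.
by left; exact: le_trans s2 s3.
Qed.

Definition dyadic (xs : seq R) n I : Prop :=
  exists i l, [/\ (i.+1 < size xs)%N, size l = n & I = bisect (xs`_i, xs`_i.+1) l].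

Lemma sorted_le (xs : seq R) i j :
  sorted <%R xs -> (i <= j)%N -> (j < size xs)%N -> xs`_i <= xs`_j.
Proof.
rewrite lt_sorted_uniq_le => /andP[_ sx] ij jn.
by apply: sorted_leq_nth => //=; [exact: le_trans|rewrite inE (leq_ltn_trans ij)].
Qed.

Lemma dyadic_lt xs n I : sorted <%R xs -> dyadic xs n I -> I.1 < I.2.
Proof.
move=> sx [i [l [si _ ->]]]; apply: (bisect_sub l _).2.
by apply: (sortedP 0 sx).
Qed.

Lemma dyadic_nested (xs : seq R) n m I K : sorted <%R xs ->
  dyadic xs n I -> dyadic xs m K -> nested n m I K.
Proof.
move=> sx [i [l [si sl ->]]] [j [k [sj sk ->]]].
have li : xs`_i < xs`_i.+1 by apply: (sortedP 0 sx).
have lj : xs`_j < xs`_j.+1 by apply: (sortedP 0 sx).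
have [e|] := eqVneq i j; first by subst; exact: bisect_nested.
rewrite neq_ltn => /orP[ij|ij]; constructor 1.
  left; have [[_ s1] _] := bisect_sub l (I := (_, _)) li.
  have [[s2 _] _] := bisect_sub k (I := (_, _)) lj.
  by apply: le_trans s1 (le_trans _ s2) => /=; apply: sorted_le => //; exact: ltnW.
right; have [[s1 _] _] := bisect_sub l (I := (_, _)) li.
have [[_ s2] _] := bisect_sub k (I := (_, _)) lj.
by apply: le_trans s2 (le_trans _ s1) => /=; apply: sorted_le => //; exact: ltnW.
Qed.

Lemma dyadic_half (xs : seq R) n I b : dyadic xs n I -> dyadic xs n.+1 (half_interval b I).
Proof.
move=> [i [l [si sl ->]]]; exists i, (rcons l b).
by rewrite size_rcons sl /bisect foldl_rcons.
Qed.

(** An endpoint of K cannot be interior to a dyadic interval of the same or a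
    greater depth. *)
Lemma dyadic_inside (xs : seq R) n m I K y : sorted <%R xs ->
  dyadic xs n I -> dyadic xs m K -> I.1 < y < I.2 -> y = K.1 \/ y = K.2 -> (n < m)%N.
Proof.
move=> sx dI dK /andP[y1 y2] yK.
have lK := dyadic_lt sx dK; have lI := dyadic_lt sx dI.
have yK' : K.1 <= y <= K.2 by case: yK => ->; rewrite lexx ?ltW.
have /andP[k1 k2] := yK'.
case: (dyadic_nested sx dI dK).
- case=> h; first by move: (le_lt_trans h (le_lt_trans k1 y2)); rewrite ltxx.
  by move: (lt_le_trans y1 (le_trans k2 h)); rewrite ltxx.
- by move=> e; subst K; case: yK => e; move: y1 y2; rewrite e ltxx.
- move=> [_ [b [s1 s2]]]; have [[t1 t2] _] := half_interval_sub b lK.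
  case: yK => e; first by move: (le_lt_trans (le_trans t1 s1) y1); rewrite e ltxx.
  by move: (lt_le_trans y2 (le_trans s2 t2)); rewrite e ltxx.
- by case.
Qed.

(** Otherwise K would lie in one half of I and could not contain the midpoint of I
    in its interior. *)
Lemma dyadic_mid (xs : seq R) n m I K : sorted <%R xs ->
  dyadic xs n I -> dyadic xs m K -> K.1 < midpoint I < K.2 -> subinterval I K.
Proof.
move=> sx dI dK /andP[y1 y2].
have lK := dyadic_lt sx dK; have lI := dyadic_lt sx dI.
have /andP[m1 m2] := midpoint_inside lI.
case: (dyadic_nested sx dI dK).
- case=> h; first by move: (le_lt_trans h (lt_trans y1 m2)); rewrite ltxx.
  by move: (lt_le_trans m1 (le_trans (ltW y2) h)); rewrite ltxx.
- by move=> <-.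
- move=> [_ [b [s1 s2]]]; have [[t1 t2] _] := half_interval_sub b lK.
  by split; [exact: le_trans s1|exact: le_trans t2].
- move=> [_ [[] [s1 s2]]].
    by move: (le_lt_trans s1 y1); rewrite ltxx.
  by move: (lt_le_trans y2 s2); rewrite ltxx.
Qed.

Lemma dyadic_mid_eq (xs : seq R) n m I K : sorted <%R xs ->
  dyadic xs n I -> dyadic xs m K -> midpoint I = midpoint K -> I = K.
Proof.
move=> sx dI dK e; have lI := dyadic_lt sx dI; have lK := dyadic_lt sx dK.
have [] := dyadic_mid sx dI dK; first by rewrite e midpoint_inside.
have [] := dyadic_mid sx dK dI; first by rewrite -e midpoint_inside.
move=> a1 a2 a3 a4; rewrite [I]surjective_pairing [K]surjective_pairing.
by congr pair; apply/eqP; rewrite eq_le ?a1 ?a2 ?a3 ?a4.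
Qed.

(** * Half-open intervals and the quadrants around a point *)

(** Cells meet along their sides.  With one end of each side left out, according to
    a fixed choice of s in each direction, they partition the domain. *)
Definition half_open (s : bool) (I : R * R) (x : R) : bool :=
  if s then I.1 <= x < I.2 else I.1 < x <= I.2.

Definition near_end (s : bool) (I : R * R) : R := if s then I.1 else I.2.

(** The cell c contains the part near p of the open quadrant at p that points
    upwards in the directions d with [s d = true] and downwards in the others. *)
Definition in_quadrant (s : bool -> bool) c p := forall d,
  half_open (s d) (side d c) (coordinate d p).

Lemma half_open_closed s I x : half_open s I x -> I.1 <= x <= I.2.
Proof. by case: s => /andP[h1 h2]; rewrite ?h1 ?h2 ltW. Qed.

Lemma half_open_inside s (I : R * R) x : I.1 < x < I.2 -> half_open s I x.
Proof. by case/andP => h1 h2; case: s; rewrite /= ?h1 ?h2 ltW. Qed.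

Lemma half_open_exists (I : R * R) x : I.1 < I.2 -> I.1 <= x <= I.2 -> exists s, half_open s I x.
Proof.
move=> h /andP[h1 h2]; have [h3|h3] := ltP x I.2; first by exists true; rewrite /= h1.
by exists false; rewrite /= h2 (lt_le_trans h).
Qed.

Lemma half_open_lt s I x : half_open s I x -> I.1 < I.2.
Proof. by case: s => /andP[h1 h2]; [exact: le_lt_trans h2|exact: lt_le_trans h2]. Qed.

Lemma half_open_sub s I K x : subinterval I K -> half_open s I x -> half_open s K x.
Proof.
move=> [s1 s2]; case: s => /andP[h1 h2] /=; apply/andP; split.
- exact: le_trans h1.
- exact: lt_le_trans s2.
- exact: le_lt_trans h1.
- exact: le_trans s2.
Qed.

Lemma half_open_near_end s (I : R * R) : I.1 < I.2 -> half_open s I (near_end s I).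
Proof. by case: s => /= h; rewrite ?lexx ?h. Qed.

Lemma half_open_end s (I : R * R) x : x = I.1 \/ x = I.2 -> half_open s I x -> x = near_end s I.
Proof. by case: s => -[->|->] /andP[] /=; rewrite ?ltxx. Qed.

Lemma near_end_half_open s s' (I : R * R) : half_open s' I (near_end s I) -> s' = s.
Proof. by case: s; case: s' => //= /andP[]; rewrite ltxx. Qed.

Lemma half_open_half s (I : R * R) x : half_open s I x ->
  exists b, half_open s (half_interval b I) x.
Proof.
case: s => /= /andP[h1 h2].
  by have [h|h] := ltP x (midpoint I); [exists false|exists true]; rewrite /= ?h1 ?h2 ?h ?andbT.
by have [h|h] := leP x (midpoint I); [exists false|exists true]; rewrite /= ?h1 ?h2 ?h ?andbT.
Qed.

Lemma half_open_half_inj s (I : R * R) x b b' : half_open s (half_interval b I) x ->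
  half_open s (half_interval b' I) x -> b = b'.
Proof.
by case: s; case: b; case: b' => //= /andP[h1 h2] /andP[h3 h4]; exfalso;
  [have := le_lt_trans h1 h4|have := le_lt_trans h3 h2|have := lt_le_trans h1 h4|have :=
    lt_le_trans h3 h2];
  rewrite ltxx.
Qed.

Lemma half_interval_near_inj s (I : R * R) b b' : I.1 < I.2 ->
  near_end s (half_interval b I) = near_end s (half_interval b' I) -> b = b'.
Proof.
move=> h; have /andP[h1 h2] := midpoint_inside h.
have := lt_eqF h1; have := gt_eqF h1; have := lt_eqF h2; have := gt_eqF h2.
by case: s; case: b; case: b' => //= e1 e2 e3 e4 /eqP; rewrite ?e1 ?e2 ?e3 ?e4.
Qed.

(** If an end of a piece lies strictly inside the interval, the piece is a half. *)
Lemma part_interval_near_midpoint s (I : R * R) q : I.1 < near_end s (part_interval q I) < I.2 ->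
  near_end s (part_interval q I) = midpoint I /\ part_interval q I = half_interval s I.
Proof. by case: s; case: q => /= /andP[h1 h2]; rewrite ?ltxx in h1 h2 *. Qed.

Lemma in_quadrant_cell s c p : in_quadrant s c p -> in_cell c p.
Proof. by move=> q; apply/in_cellP => d; exact: half_open_closed (q d). Qed.

Lemma in_cell_quadrant c p : (forall d, (side d c).1 < (side d c).2) -> in_cell c p ->
  exists s, in_quadrant s c p.
Proof.
move=> h /in_cellP H; have [s0 h0] := half_open_exists (h false) (H false).
have [s1 h1] := half_open_exists (h true) (H true).
by exists (fun d => if d then s1 else s0) => -[].
Qed.

Lemma in_quadrant_near_end s c v : corner c v -> in_quadrant s c v ->
  forall d, coordinate d v = near_end (s d) (side d c).
Proof. by move=> /cornerP e q d; apply: half_open_end (e d) (q d). Qed.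

Definition dirs (d s t : bool) : bool -> bool := fun d' => if d' == d then s else t.

Lemma in_quadrant_dirs d s t c p : half_open s (side d c) (coordinate d p) ->
  half_open t (side (~~ d) c) (coordinate (~~ d) p) -> in_quadrant (dirs d s t) c p.
Proof. by move=> h1 h2 d'; rewrite /dirs; case: eqP => [->//|]; case: d d' h1 h2 => [] []. Qed.

Lemma cell_eq c c' : (forall d, side d c = side d c') -> c = c'.
Proof.
by move=> h; move: (h false) (h true); case: c {h} => ? ? ? ?;
  case: c' => ? ? ? ? /= [-> ->] [-> ->].
Qed.

Lemma subinterval_in_cell c t p : (forall d, subinterval (side d c) (side d t)) -> in_cell c p -> in_cell t p.
Proof.
move=> s /in_cellP h; apply/in_cellP => d; have [s1 s2] := s d; have /andP[h1 h2] := h d.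
by rewrite (le_trans s1 h1) (le_trans h2 s2).
Qed.

Lemma subinterval_corner c t v : (forall d, subinterval (side d c) (side d t)) -> in_cell c v ->
  corner t v -> corner c v.
Proof.
move=> s /in_cellP h /cornerP e; apply/cornerP => d; have [s1 s2] := s d; have /andP[h1 h2] := h d.
case: (e d) => E; [left|right]; apply/eqP; rewrite eq_le.
  by rewrite h1 E s1.
by rewrite h2 E s2.
Qed.

(** Points beyond a side of the rectangle are arbitrarily close to that side. *)
Lemma interior_cell c v :
  interior (in_cell c : set (R * R)) v <-> forall d, (side d c).1 < coordinate d v < (side d c).2.
Proof.
split=> [|h]; last first.
  exists ([set` `]xlo c, xhi c[], [set` `]ylo c, yhi c[]).
    by split; apply: near_in_itvoo; rewrite in_itv /=; [exact: (h false)|exact: (h true)].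
  move=> [x y] [/=]; rewrite !in_itv /= => /andP[x1 x2] /andP[y1 y2].
  by rewrite /in_cell /= !ltW.
move=> /nbhs_ballP[e /= e0 H] d; have e2 : 0 < e / 2 by rewrite divr_gt0.
have e2' : `|e / 2| < e by rewrite gtr0_norm // ltr_pdivrMr // ltr_pMr // ltr1n.
have B x : `|coordinate d v - x| < e -> in_cell c (set_coordinate d x v).
  by move=> hx; apply: H; split; case: d hx => //= _; rewrite /ball /= subrr normr0.
have h1 := B (coordinate d v - e / 2); have h2 := B (coordinate d v + e / 2).
have a1 : coordinate d v - (coordinate d v - e / 2) = e / 2 by ring.
have a2 : coordinate d v - (coordinate d v + e / 2) = - (e / 2) by ring.
move: h1 h2; rewrite a1 a2 normrN.
move=> /(_ e2')/in_cellP/(_ d) h1 /(_ e2')/in_cellP/(_ d) h2; move: h1 h2.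
have l1 : coordinate d v - e / 2 < coordinate d v by rewrite ltrBlDr ltrDl.
have l2 : coordinate d v < coordinate d v + e / 2 by rewrite ltrDl.
have cp x : coordinate d (set_coordinate d x v) = x by case: (d).
rewrite !cp => /andP[h1 _] /andP[_ h2].
by rewrite (le_lt_trans h1) ?(lt_le_trans _ h2).
Qed.

(** A rectangle is the closure of its interior, in the quantitative form needed
    for polynomials: every neighbourhood of one of its points contains a smaller
    nondegenerate rectangle. *)
Lemma small_box c p (B : set (R * R)) : (forall d, (side d c).1 < (side d c).2) ->
  in_cell c p -> nbhs p B ->
  exists c0, [/\ xlo c0 < xhi c0, ylo c0 < yhi c0 & forall q, in_cell c0 q -> in_cell c q /\ B q].
Proof.
move=> l /in_cellP cp /nbhs_ballP[e /= e0 H]; have e2 : 0 < e / 2 by rewrite divr_gt0.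
have e2' : e / 2 < e by rewrite ltr_pdivrMr // ltr_pMr // ltr1n.
pose lo d := Num.max (side d c).1 (coordinate d p - e / 2).
pose hi d := Num.min (side d c).2 (coordinate d p + e / 2).
have lh d : lo d < hi d.
  rewrite /lo /hi lt_min !gt_max l /=; have /andP[h1 h2] := cp d.
  by apply/and3P; split; lra.
exists (Cell (lo false) (hi false) (lo true) (hi true)); split; [exact: lh|exact: lh|].
move=> q /in_cellP cq; have cq' d : lo d <= coordinate d q <= hi d by have := cq d; case: d.
have B' d : `|coordinate d p - coordinate d q| < e.
  have := cq' d; rewrite /lo /hi ge_max le_min => /andP[/andP[_ h1] /andP[_ h2]].
  by rewrite ltr_norml; apply/andP; split; lra.
split; last by apply: H; split; [exact: (B' false)|exact: (B' true)].
apply/in_cellP => d; have := cq' d; rewrite /lo /hi ge_max le_min.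
by move=> /andP[/andP[-> _] /andP[-> _]].
Qed.

(** A nonzero bicubic does not vanish on any small rectangle. *)
Lemma supp_cell c a b : (forall d, (side d c).1 < (side d c).2) -> a != 0 ->
  (forall p, in_cell c p -> b p = bicubic a p) -> (in_cell c : set (R * R)) `<=` supp b.
Proof.
move=> l a0 H p cp B Bp; apply: contrapT => no.
have [c0 [lx ly H0]] := small_box l cp Bp.
move/eqP: a0; apply; apply: (bicubic_eq0 lx ly) => q /H0[cq Bq].
rewrite -(H q cq); apply: contrapT => /eqP bq; apply: no; exists q; split=> //.
Qed.

(** * Dyadic meshes and their basis vertices *)

Section Mesh.
Variables (xs ys : seq R).
Hypotheses (hxs : (1 < size xs)%N) (hys : (1 < size ys)%N).
Hypotheses (sxs : sorted <%R xs) (sys : sorted <%R ys).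
Implicit Types (C : set (cell R)) (J : R * R -> 'M[R]_2) (A : cell R -> 'M[R]_4).

Definition grid (d : bool) : seq R := if d then ys else xs.

Definition domain : cell R := Cell xs`_0 xs`_(size xs).-1 ys`_0 ys`_(size ys).-1.

(** The last two fields say that for each of the four choices of half-open
    cells these partition the half-open domain.  This expresses that the cells cover
    the domain without overlap in a form that subdivision obviously preserves. *)
Record is_mesh C : Prop := IsMesh {
  mesh_finite : finite_set C;
  mesh_dyadic : forall c d, C c -> exists n, dyadic (grid d) n (side d c);
  mesh_cover : forall s p, in_quadrant s domain p -> exists2 c, C c & in_quadrant s c p;
  mesh_unique : forall s p c c', C c -> C c' -> in_quadrant s c p -> in_quadrant s c' p -> c = c' }.

Lemma sorted_grid d : sorted <%R (grid d). Proof. by case: d. Qed.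

Lemma size_grid d : (1 < size (grid d))%N. Proof. by case: d. Qed.

Lemma side_domain d : side d domain = ((grid d)`_0, (grid d)`_(size (grid d)).-1).
Proof. by case: d. Qed.

Lemma domain_lt d : (side d domain).1 < (side d domain).2.
Proof.
rewrite side_domain /=; have := size_grid d; have := sorted_grid d.
case: (grid d) => // a [//|b r] sg _ /=.
apply: (@lt_le_trans _ _ [:: a, b & r]`_1); first by case/andP: sg.
exact: (@sorted_le [:: a, b & r] 1 (size r).+1).
Qed.

Lemma mesh_lt C c : is_mesh C -> C c -> forall d, (side d c).1 < (side d c).2.
Proof. by move=> m cc d; have [n] := mesh_dyadic m d cc; exact: dyadic_lt (sorted_grid d). Qed.

Lemma mesh_sub C c : is_mesh C -> C c -> forall d, subinterval (side d c) (side d domain).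
Proof.
move=> m cc d; have [n [i [l [si sl ->]]]] := mesh_dyadic m d cc.
have sg := sorted_grid d; rewrite side_domain.
have li : (grid d)`_i < (grid d)`_i.+1 by apply: (sortedP 0 sg).
have [[/= s1 s2] _] := bisect_sub l (I := (_, _)) li.
split; first by apply: le_trans s1; exact: sorted_le (ltnW _).
by apply: le_trans s2 _; apply: sorted_le => //; case: (size _) si.
Qed.

Lemma mesh_in_quadrant_domain C c s p : is_mesh C -> C c -> in_quadrant s c p ->
  in_quadrant s domain p.
Proof. by move=> m cc q d; exact: half_open_sub (mesh_sub m cc d) (q d). Qed.

Lemma mesh_in_cell_quadrant C c p : is_mesh C -> C c -> in_cell c p -> exists s, in_quadrant s c p.
Proof. by move=> m cc; apply: in_cell_quadrant; exact: mesh_lt cc. Qed.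

Lemma regionE C : is_mesh C -> region C = (in_cell domain : set _).
Proof.
move=> m; apply/seteqP; split => p.
  by move=> [c cc /(mesh_in_cell_quadrant m cc)[s /(mesh_in_quadrant_domain m
    cc)/in_quadrant_cell]].
move=> /(in_cell_quadrant domain_lt)[s /(mesh_cover m)[c cc /in_quadrant_cell]].
by exists c.
Qed.

Lemma mesh_in_domain C c p : is_mesh C -> C c -> in_cell c p -> in_cell domain p.
Proof. by move=> m cc cp; rewrite -(regionE m); exists c. Qed.

(** The geometric description of a basis vertex, see [basis_vertexP]. *)
Definition full_vertex C v := in_cell domain v /\ forall c, C c -> in_cell c v -> corner c v.

Lemma full_vertex_vertex C v : is_mesh C -> full_vertex C v -> vertex C v.
Proof.
move=> m [vd F]; have [s q] := in_cell_quadrant domain_lt vd; have [c cc qc] := mesh_cover m q.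
by exists c => //; exact: F (in_quadrant_cell qc).
Qed.

Lemma full_vertex_region C v : is_mesh C -> full_vertex C v -> region C v.
Proof. by move=> m [vd _]; rewrite regionE. Qed.

Lemma finite_full_vertex C : is_mesh C -> finite_set [set v | full_vertex C v].
Proof.
move=> m; have fb : finite_set [set: bool] by exact: finite_finset.
have := finite_image (fun x => corner_of x.1 x.2.1 x.2.2) (finite_setX (mesh_finite m)
  (finite_setX fb fb)).
apply: sub_finite_set => v /(full_vertex_vertex m)[c cc /corner_ofP[s [t ->]]].
by exists (c, (s, t)).
Qed.

Lemma interiorE C v : is_mesh C -> interior (region C) v <->
  forall d, (side d domain).1 < coordinate d v < (side d domain).2.
Proof. by move=> m; rewrite regionE //; exact: interior_cell. Qed.

Lemma interior_in_quadrant C v s : is_mesh C -> interior (region C) v -> in_quadrant s domain v.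
Proof. by move=> m /(interiorE _ m) h d; apply: half_open_inside. Qed.

(** The four predicates that define the valence, parametrised by the direction d
    and the orientation s. *)
Definition leaves (d s : bool) C v : Prop := exists c,
  [/\ C c, at_end (~~ d) c v & half_open s (side d c) (coordinate d v)].

Lemma valenceE C v : valence C v =
  (`[< leaves false true C v >] + `[< leaves false false C v >]
   + `[< leaves true true C v >] + `[< leaves true false C v >])%N.
Proof.
have E (P Q : Prop) : (P <-> Q) -> `[< P >] = `[< Q >] by move=> PQ; apply/asboolP/asboolP => /PQ.
rewrite /valence; congr ((_ + _ + _ + _)%N); congr nat_of_bool; apply: E;
  by split; [case=> c [h1 [h2 h3]]; exists c|case=> c [h1 h2 h3]; exists c].
Qed.

Lemma in_quadrant_leaves d C c s v : C c -> corner c v -> in_quadrant s c v -> leaves d (s d) C v.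
Proof. by move=> cc /cornerP e q; exists c. Qed.

(** If v were strictly inside the side of a cell in direction d, one of the two
    grid lines leaving v in the other direction would bound a cell that overlaps
    this cell. *)
Lemma crossing_vertexP C v : is_mesh C ->
  crossing_vertex C v <-> interior (region C) v /\ full_vertex C v.
Proof.
move=> m; split.
  case=> -[_ vi] val; split=> //; split.
    by rewrite -(regionE m); exact: interior_subset vi.
  move=> c cc cv; apply/cornerP => d; have [//|st] := at_end_or_inside d cv; exfalso.
  have [s hs] : exists s, half_open s (side (~~ d) c) (coordinate (~~ d) v).
    by apply: half_open_exists (mesh_lt m cc (~~ d)) _; move/in_cellP: cv; exact.
  have [c1 [c1c]] : leaves (~~ d) s C v.
    move: val; rewrite valenceE.
    by do 4![case: asboolP => ?] => // _; case: (d) (s) => [] [].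
  rewrite negbK => e1 h1; have h1' : half_open (coordinate d v == (side d c1).1) (side d c1)
    (coordinate d v).
    have := mesh_lt m c1c d; case: e1 => ->; first by rewrite eqxx /= lexx.
    by move=> l; rewrite gt_eqF //= l lexx.
  have E := mesh_unique m c1c cc (in_quadrant_dirs h1' h1) (in_quadrant_dirs (half_open_inside _ st) hs).
  by subst c1; exact: inside_not_at_end st e1.
case=> vi [vd F]; have q s : exists2 c, C c & in_quadrant s c v.
  by apply: (mesh_cover m); exact: interior_in_quadrant m vi.
have L d s : leaves d s C v.
  have [c cc qc] := q (fun=> s); have := F _ cc (in_quadrant_cell qc).
  by move=> k; exact: in_quadrant_leaves k qc.
split.
  have [c cc qc] := q (fun=> true); split=> //; exists c => //.
  exact: F (in_quadrant_cell qc).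
by rewrite valenceE !asboolT.
Qed.

(** In the direction normal to the boundary all cells containing v lie on the same
    side of v and have an end there.  A cell with v strictly inside its tangential
    side would overlap the cell of which v is a corner. *)
Lemma boundary_vertexP C v : is_mesh C ->
  boundary_vertex C v <-> ~ interior (region C) v /\ full_vertex C v.
Proof.
move=> m; split; last first.
  move=> [vi [vd F]]; have := vd; rewrite -(regionE m) => vr; split=> //.
  by have [c cc cv] := vr; exists c => //; exact: F.
move=> [[c cc cv] [vr vi]]; split=> //; have := vr; rewrite regionE // => vd; split=> //.
(* d0 is the direction normal to the boundary at v. *)
have [d0 [s0 E0]] : exists d s, coordinate d v = near_end s (side d domain).
  apply: contrapT => H; apply: vi; apply/(interiorE _ m) => d.
  have [[e|e]|//] := at_end_or_inside d vd; exfalso; apply: H; exists d.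
    by exists true.
  by exists false.
have B c' s : C c' -> in_quadrant s c' v -> s d0 = s0.
  move=> c'c /(mesh_in_quadrant_domain m c'c)/(_ d0); rewrite E0; exact: near_end_half_open.
have N c' : C c' -> in_cell c' v -> at_end d0 c' v.
  move=> c'c c'v; have [//|/(half_open_inside (~~ s0)) h] := at_end_or_inside d0 c'v.
  have [s q] := mesh_in_cell_quadrant m c'c c'v.
  by have := B c' _ c'c (in_quadrant_dirs h (q (~~ d0))); rewrite /dirs eqxx; case: (s0).
move=> c' c'c c'v; apply/cornerP => d.
have [->|] := eqVneq d d0; first exact: N.
move=> nd; have {d nd}-> : d = ~~ d0 by case: d d0 nd {E0 B N} => [] [].
have [//|st] := at_end_or_inside (~~ d0) c'v; exfalso.
have [s q] := mesh_in_cell_quadrant m cc (corner_in (mesh_lt m cc) cv).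
have [s' q'] := mesh_in_cell_quadrant m c'c c'v.
have sd : s d0 = s' d0 by rewrite (B _ _ cc q) (B _ _ c'c q').
have E : c = c'.
  apply: (mesh_unique m cc c'c) (in_quadrant_dirs (q d0) (q (~~ d0))) _.
  by apply: in_quadrant_dirs; [rewrite sd; exact: q'|exact: half_open_inside].
by subst c'; move/cornerP: cv => /(_ (~~ d0)); exact: inside_not_at_end.
Qed.

Lemma basis_vertexP C v : is_mesh C -> basis_vertex C v <-> full_vertex C v.
Proof.
move=> m; split; first by case=> [/(boundary_vertexP _ m)[]|/(crossing_vertexP _ m)[]].
move=> F; have [vi|vi] := pselect (interior (region C) v).
  by right; apply/crossing_vertexP.
by left; apply/boundary_vertexP.
Qed.

(** Let c have a corner at v.  Grid lines leave v along both sides of c.  The cell in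
    the opposite quadrant does not contain v in its interior, as it differs from c,
    so a third grid line leaves v; four would make v a crossing vertex. *)
Lemma T_vertexP C v : is_mesh C -> vertex C v -> ~ full_vertex C v -> T_vertex C v.
Proof.
move=> m [c cc cv] nF.
have cv' := corner_in (mesh_lt m cc) cv.
have vi : interior (region C) v.
  apply: contrapT => h; apply: nF; apply: (proj1 (boundary_vertexP _ m) _).2; split;
    first by exists c.
  by split=> //; exists c.
have vv : vertex C v by exists c.
split=> //; have val4 : valence C v <> 4%N.
  by move=> e; apply: nF; apply: (proj1 (crossing_vertexP _ m) _).2.
have [s q] := mesh_in_cell_quadrant m cc cv'.
have [c' c'c q'] := mesh_cover m (interior_in_quadrant (fun d => ~~ s d) m vi).
have L d : leaves d (s d) C v by exact: in_quadrant_leaves cv q.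
have [d Ld] : exists d, leaves d (~~ s d) C v.
  apply: contrapT => H; have cs : c' = c.
    apply: (mesh_unique m c'c cc) q => d; apply: half_open_inside.
    have [e|//] := at_end_or_inside d (in_quadrant_cell q'); exfalso; apply: H; exists (~~ d).
    by exists c'; rewrite negbK; split=> //; exact: q'.
  subst c'; have := q' true; have /cornerP/(_ true) := cv.
  by move=> e; rewrite (half_open_end e (q true)) => /near_end_half_open; case: (s true).
move: (L false) (L true) Ld val4; rewrite valenceE.
by case: d; case: (s false); case: (s true) => /= A B D; do 4![case: asboolP => ? //].
Qed.

(** * Splines as fields of jets *)

(** Having one field J for all cells builds in the agreement of the pieces; the
    spline itself is the entry (0, 0) of J. *)
Definition jet_spline C J : Prop := exists A, forall c p, C c -> in_cell c p -> J p = jet (A c) p.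

Lemma jet_splineD C J K : jet_spline C J -> jet_spline C K -> jet_spline C (fun p => J p + K p).
Proof.
by move=> [A HA] [B HB]; exists (fun c => A c + B c) => c p cc cp; rewrite jetD -HA // -HB.
Qed.

Lemma jet_splineZ C k J : jet_spline C J -> jet_spline C (fun p => k *: J p).
Proof. by move=> [A HA]; exists (fun c => k *: A c) => c p cc cp; rewrite jetZ -HA. Qed.

Lemma jet_spline0 C : jet_spline C (fun=> 0).
Proof. by exists (fun=> 0) => c p _ _; rewrite jet0. Qed.

Lemma jet_spline_sum C (I : Type) (r : seq I) (k : I -> R) (J : I -> R * R -> 'M[R]_2) :
  (forall i, jet_spline C (J i)) -> jet_spline C (fun p => \sum_(i <- r) k i *: J i p).
Proof.
move=> H; elim: r => [|i r IH].
  by under eq_fun do rewrite big_nil; exact: jet_spline0.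
under eq_fun do rewrite big_cons.
by apply: (jet_splineD (J := fun p => k i *: J i p)) => //; exact: jet_splineZ.
Qed.

Lemma jet_hermite_corner C c D v : is_mesh C -> C c -> corner c v -> jet (hermite c D) v = D v.
Proof.
move=> m cc /corner_ofP[s [t ->]]; apply: jet_hermite.
  exact: (mesh_lt m cc false).
exact: (mesh_lt m cc true).
Qed.

(** Degenerate if the two cells only touch. *)
Definition overlap c c' : cell R :=
  Cell (Num.max (xlo c) (xlo c')) (Num.min (xhi c) (xhi c'))
       (Num.max (ylo c) (ylo c')) (Num.min (yhi c) (yhi c')).

Lemma side_overlap d c c' : side d (overlap c c') =
  (Num.max (side d c).1 (side d c').1, Num.min (side d c).2 (side d c').2).
Proof. by case: d. Qed.

Lemma overlap_in c c' p : in_cell (overlap c c') p <-> in_cell c p /\ in_cell c' p.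
Proof.
rewrite !in_cellP; split=> [H|[H H'] d].
  by split=> d; have := H d; rewrite side_overlap ge_max le_min =>
    /andP[/andP[h1 h2] /andP[h3 h4]]; apply/andP.
rewrite side_overlap ge_max le_min.
by have /andP[-> ->] := H d; have /andP[-> ->] := H' d.
Qed.

Lemma overlap_eq C c c' : is_mesh C -> C c -> C c' ->
  (forall d, (side d (overlap c c')).1 < (side d (overlap c c')).2) -> c = c'.
Proof.
move=> m cc c'c H.
(* Both half-open cells contain the lower left corner of the overlap. *)
apply: (mesh_unique m cc c'c (s := fun=> true)
  (p := ((side false (overlap c c')).1, (side true (overlap c c')).1))) => d; have := H d;
  rewrite side_overlap /= lt_min gt_max !gt_max => /andP[/andP[a1 a2] /andP[a3 a4]];
  by case: d {H} a1 a2 a3 a4 => /= a1 a2 a3 a4; rewrite le_max lexx ?orbT gt_max ?a1 ?a2 ?a3 ?a4.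
Qed.

(** Two different cells touch in a segment or a point, whose ends are ends of
    both cells in one direction and of at least one of them in the other. *)
Lemma overlap_vertex C c c' p v : is_mesh C -> C c -> C c' -> c <> c' ->
  in_cell (overlap c c') p -> corner (overlap c c') v -> vertex C v.
Proof.
move=> m cc c'c ne po /cornerP vo.
have [d deg] : exists d, (side d (overlap c c')).1 = (side d (overlap c c')).2.
  apply: contrapT => H; apply: ne; apply: (overlap_eq m) => // d.
  have /in_cellP/(_ d)/andP[h1 h2] := po.
  by rewrite lt_neqAle (le_trans h1 h2) andbT; apply/eqP => e; apply: H; exists d.
have [e1 e2] : at_end d c v /\ at_end d c' v.
  have l := mesh_lt m cc d; have l' := mesh_lt m c'c d.
  have : coordinate d v = (side d (overlap c c')).1 by case: (vo d) => ->.
  move: deg; rewrite /at_end side_overlap /=; case: leP => h1; case: leP => h2 e1 e2; subst.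
  - by split; [right; rewrite e2|left].
  - by move: l'; rewrite e1 ltxx.
  - by move: l; rewrite e1 ltxx.
  - by split; [left|right; rewrite e2].
have : at_end (~~ d) c v \/ at_end (~~ d) c' v.
  have := vo (~~ d); rewrite /at_end side_overlap /=.
  by case: leP => _; case: leP => _ [] ->; tauto.
by case=> e3; [exists c|exists c'] => //; apply/cornerP => d';
  have [->//|] := eqVneq d' d; case: d' d e1 e2 e3 {deg vo} => [] [].
Qed.

(** Agreement of the pieces at the vertices suffices: the intersection of two
    cells has vertices as corners, and the jets at these corners determine the
    jets in between. *)
Lemma jet_spline_glue C A J : is_mesh C ->
  (forall c v, C c -> in_cell c v -> vertex C v -> jet (A c) v = J v) ->
  exists2 K, jet_spline C K & forall c p, C c -> in_cell c p -> K p = jet (A c) p.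
Proof.
move=> m H.
suff /choice[K HK] p : exists y, forall c, C c -> in_cell c p -> y = jet (A c) p.
  by exists K; [exists A|] => c p cc cp; exact: HK.
have [[c' c'c c'p]|no] := pselect (exists2 c, C c & in_cell c p); last first.
  by exists 0 => c cc cp; exfalso; apply: no; exists c.
exists (jet (A c') p) => c cc cp.
have [->//|ne] := pselect (c' = c).
have po : in_cell (overlap c' c) p by apply/overlap_in.
apply: (jet_corners po) => v vo.
have vin : in_cell (overlap c' c) v.
  apply/in_cellP => d; move/in_cellP/(_ d)/andP: po => [h1 h2].
  by move/cornerP/(_ d): vo => [] ->; rewrite lexx ?andbT (le_trans h1).
have [i1 i2] := (overlap_in _ _ _).1 vin.
have vv := overlap_vertex m c'c cc ne po vo.
by rewrite !H.
Qed.

(** The depth at which y appears as an endpoint in the dyadic subdivision. *)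
Definition level d (y : R) n :=
  exists I m, [/\ (m <= n)%N, dyadic (grid d) m I & y = I.1 \/ y = I.2].

Lemma level_corner C c v d : is_mesh C -> C c -> corner c v -> exists n, level d (coordinate d v) n.
Proof.
move=> m cc /cornerP/(_ d) e; have [n dn] := mesh_dyadic m d cc.
by exists n, (side d c), n; split.
Qed.

Lemma level_inside c d n y w : (exists k, dyadic (grid d) k (side d c)) -> level d y n ->
  (side d c).1 < y < (side d c).2 -> at_end d c w ->
    exists2 k, (k < n)%N & level d (coordinate d w) k.
Proof.
move=> [k dk] [I [m [mn dI yI]]] yc e.
have km := dyadic_inside (sorted_grid d) dk dI yc yI.
by exists k; [exact: leq_trans mn|exists (side d c), k; split].
Qed.

(** Induction on the sum of the levels of the two coordinates.  If v is not a
    corner of the cell c containing it, the corners of the face of c through v share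
    the coordinates in which v is at an end of c and have lower levels in the
    others. *)
Lemma jet_spline_vertex_eq0 C J : is_mesh C -> jet_spline C J ->
  (forall v, full_vertex C v -> J v = 0) -> forall v, vertex C v -> J v = 0.
Proof.
move=> m [A HA] J0 v [c0 c0c c0v].
have [n0 l0] := level_corner false m c0c c0v; have [n1 l1] := level_corner true m c0c c0v.
have [k] := ubnP (n0 + n1)%N; elim: k n0 n1 v c0 c0c c0v l0 l1 => // k IH n0 n1 v c0 c0c c0v l0 l1.
rewrite ltnS => nk.
have [fv|nfv] := pselect (full_vertex C v); first exact: J0.
have vd : in_cell domain v by apply: (mesh_in_domain m c0c); exact: corner_in (mesh_lt m c0c) c0v.
have [c cc [cv ncv]] : exists2 c, C c & in_cell c v /\ ~ corner c v.
  apply: contrapT => H; apply: nfv; split=> // c cc cv; apply: contrapT => h.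
  by apply: H; exists c.
rewrite (HA c) // -(jet0 v); apply: (jet_face cv) => w cw fw.
rewrite jet0 -(HA c) //; last exact: corner_in (mesh_lt m cc) cw.
(* The level does not increase, and it decreases where v is not at an end. *)
have lw d n : level d (coordinate d v) n ->
    exists k', [/\ level d (coordinate d w) k', (k' <= n)%N & ~ at_end d c v -> (k' < n)%N].
  move=> ln; have [e|st] := at_end_or_inside d cv.
    by exists n; rewrite fw //; split.
  have [k' kn lk] := level_inside (mesh_dyadic m d cc) ln st ((cornerP c w).1 cw d).
  by exists k'; split=> //; exact: ltnW.
have [k0 [lk0 k0n s0]] := lw _ _ l0; have [k1 [lk1 k1n s1]] := lw _ _ l1.
apply: (IH k0 k1 w c) => //; apply: leq_trans nk.
have [e0|/s0 h0] := pselect (at_end false c v); last first.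
  by rewrite -addSn leq_add.
have [e1|/s1 h1] := pselect (at_end true c v); last by rewrite -addnS leq_add.
by exfalso; apply: ncv; apply/cornerP => -[].
Qed.

Lemma jet_spline_unique C J : is_mesh C -> jet_spline C J ->
  (forall v, full_vertex C v -> J v = 0) -> forall p, region C p -> J p = 0.
Proof.
move=> m sJ J0 p [c cc cp]; have [A HA] := sJ.
rewrite (HA c) // -(jet0 p); apply: (jet_corners cp) => v cv.
rewrite jet0 -(HA c) //; last exact: corner_in (mesh_lt m cc) cv.
by apply: (jet_spline_vertex_eq0 m sJ J0); exists c.
Qed.

(** A spline has only one jet field. *)
Lemma jet_spline_value_eq0 C J : is_mesh C -> jet_spline C J ->
  (forall p, region C p -> J p 0 0 = 0) -> forall p, region C p -> J p = 0.
Proof.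
move=> m [A HA] J0 p [c cc cp]; rewrite (HA c) //.
rewrite (bicubic_eq0 (mesh_lt m cc false) (mesh_lt m cc true) (a := A c)) ?jet0 // => q cq.
by rewrite /bicubic -(HA c) // J0 //; exists c.
Qed.

(** * Jet fields and the class of continuous differentiability *)

(** Cells are encoded by their four numbers, because the enumeration of a finite
    set asks for a type with decidable equality. *)
Lemma finite_near (X : topologicalType) (p : X) (C : set (cell R)) (P : cell R -> X -> Prop) :
  finite_set C -> (forall c, C c -> \forall q \near p, P c q) ->
  \forall q \near p, forall c, C c -> P c q.
Proof.
move=> fC H; pose f (c : cell R) := (side false c, side true c).
pose g (x : (R * R) * (R * R)) := Cell x.1.1 x.1.2 x.2.1 x.2.2.
have gf c : g (f c) = c by case: c.
have [s Es] := (finite_seqP _).1 (finite_image f fC).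
have {}H x : x \in s -> \forall q \near p, P (g x) q.
  move=> xs_; have : (f @` C) x by rewrite Es.
  by case=> c cc <-; rewrite gf; exact: H.
have : \forall q \near p, forall x, x \in s -> P (g x) q.
  elim: s {Es} H => [|x s IH] H; first by apply: nearW.
  have := H x (mem_head _ _); have /IH := fun y ys_ => H y (mem_behead (s := x :: s) ys_).
  by apply: filterS2 => q h1 h2 y; rewrite inE => /orP[/eqP ->|/h1].
apply: filterS => q h c cc; rewrite -(gf c); apply: h.
by have : (f @` C) (f c) by [exists c]; rewrite Es.
Qed.

Lemma continuous_coordinate d (p : R * R) : coordinate d q @[q --> p] --> coordinate d p.
Proof. by case: d; [exact: cvg_snd|exact: cvg_fst]. Qed.

(** Cells are closed and there are finitely many of them. *)
Lemma near_cells C p : is_mesh C -> \forall q \near p, forall c, C c -> in_cell c q -> in_cell c p.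
Proof.
move=> m; apply: finite_near (mesh_finite m) _ => c cc.
have [cp|ncp] := pselect (in_cell c p); first by apply: (@nearW _ (nbhs p)) => q _.
have [d] : exists d, ~~ ((side d c).1 <= coordinate d p <= (side d c).2).
  apply: contrapT => H; apply: ncp; apply/in_cellP => d.
  by apply: contrapT => h; apply: H; exists d; apply/negP.
rewrite negb_and -!ltNge => /orP[h|h].
  near=> q => /in_cellP/(_ d)/andP[h1 _].
  suff: coordinate d q < (side d c).1 by rewrite ltNge h1.
  by near: q; apply: (cvgr_lt (coordinate d p)) h; exact: continuous_coordinate.
near=> q => /in_cellP/(_ d)/andP[_ h1].
suff: (side d c).2 < coordinate d q by rewrite ltNge h1.
by near: q; apply: (cvgr_gt (coordinate d p)) h; exact: continuous_coordinate.
Unshelve. all: by end_near. Qed.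

Lemma continuous_sum4 (X : topologicalType) (f : 'I_4 -> X -> R) (p : X) :
  (forall k, {for p, continuous (f k)}) -> {for p, continuous (fun q => \sum_k f k q)}.
Proof.
move=> H; rewrite /prop_for /continuous_at; under eq_fun do rewrite sum4.
by rewrite sum4; do 3![apply: cvgD; last exact: H]; exact: H.
Qed.

Lemma continuous_jet1 d (p : R * R) i k : {for p, continuous (fun q => jet1 (coordinate d q) i k)}.
Proof.
rewrite /prop_for /continuous_at mxE; under eq_fun do rewrite mxE.
have cX n : coordinate d q ^+ n @[q --> p] --> coordinate d p ^+ n.
  by apply: (@continuous_comp _ _ _ (coordinate d) (fun x => x ^+ n));
    [exact: continuous_coordinate|exact: exprn_continuous].
case: (i == 0); first exact: cX.
by apply: cvgMn; exact: cX.
Qed.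

Lemma continuous_jet a p i j : {for p, continuous (fun q => jet a q i j)}.
Proof.
rewrite (_ : (fun q => _) = fun q => \sum_(k < 4) \sum_(l < 4)
  jet1 q.1 i k * a k l * jet1 q.2 j l); last by apply/funext => q; exact: jet_entry.
do 2![apply: continuous_sum4 => ?].
apply: cvgM; last exact: (continuous_jet1 (d := true)).
by apply: cvgM; [exact: (continuous_jet1 (d := false))|exact: cvg_cst].
Qed.

Lemma derive_jet1 n (u : 'M[R]_(4, n)) j x :
  is_derive x (1 : R) (fun t => (jet1 t *m u) 0 j) ((jet1 x *m u) 1 j).
Proof.
have [_ ->] := jet1E x u j.
rewrite (_ : (fun t => _) = fun t : R => u (inord 0) j + u (inord 1) j * t + u (inord 2) j * t ^+ 2 +
  u (inord 3) j * t ^+ 3); last first.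
  by apply/funext => t; have [] := jet1E t u j.
apply: is_derive_eq; rewrite /GRing.scale /=; ring.
Qed.

Lemma derive_jet_x a p j : is_derive p.1 (1 : R) (fun x => jet a (x, p.2) 0 j) (jet a p 1 j).
Proof.
have := derive_jet1 (a *m (jet1 p.2)^T) j p.1.
rewrite mulmxA -/(jet a p); congr is_derive; apply/funext => t.
by rewrite mulmxA.
Qed.

Lemma derive_jet_y a p i : is_derive p.2 (1 : R) (fun y => jet a (p.1, y) i 0) (jet a p i 1).
Proof.
have := derive_jet1 (a^T *m (jet1 p.1)^T) i p.2.
have E y k : (jet1 y *m (a^T *m (jet1 p.1)^T)) k i = jet a (p.1, y) i k.
  by rewrite -trmx_mul -[jet1 y]trmxK -trmx_mul mxE.
by rewrite E /=; rewrite -surjective_pairing; congr is_derive; apply/funext => t.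
Qed.

Lemma near_jets C A p (e : R) : is_mesh C -> 0 < e ->
  \forall q \near p, forall c, C c -> forall i j, `|jet (A c) p i j - jet (A c) q i j| < e.
Proof.
move=> m e0; apply: finite_near (mesh_finite m) _ => c cc.
have H i j : \forall q \near p, `|jet (A c) p i j - jet (A c) q i j| < e.
  by have /cvgrPdist_lt/(_ e e0) := @continuous_jet (A c) p i j.
near=> q => i j; move: i j.
by apply: ord2P; apply: ord2P; near: q; exact: H.
Unshelve. all: by end_near. Qed.

Lemma jet_field_continuous C J i j : is_mesh C -> jet_spline C J ->
  {within region C, continuous (fun p => J p i j)}.
Proof.
move=> m [A HA]; apply/subspace_continuousP => p _.
apply/cvgrPdist_lt => e e0; rewrite near_withinE.
near=> q => -[c cc cq].
have cp : in_cell c p by move: (c) cc cq; near: q; exact: near_cells.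
rewrite -[X in `|X|]/(J p i j - J q i j) (HA c p cc cp) (HA c q cc cq).
by move: (c) cc i j; near: q; exact: near_jets.
Unshelve. all: by end_near. Qed.

(** Near x the function G takes, at every point, the value of one of finitely
    many functions that agree with G at x and have the same derivative there, so its
    difference quotients are among theirs. *)
Lemma derive_glue (G : R -> R) (I : set (cell R)) (g : cell R -> R -> R) (x l : R) :
  finite_set I -> (forall c, I c -> is_derive x 1 (g c) l) ->
  (\forall t \near x, exists2 c, I c & G t = g c t /\ G x = g c x) ->
  is_derive x 1 G l.
Proof.
move=> fI Hg HG.
suff H : h^-1 *: ((G \o shift x) (h *: (1 : R)) - G x) @[h --> 0^'] --> l.
  by apply: DeriveDef; [apply/cvg_ex; exists l|exact/cvg_lim].
apply/cvgrPdist_lt => e e0.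
have near_g : \forall h \near (0 : R), forall c, I c -> h != 0 ->
    `|l - h^-1 *: ((g c \o shift x) (h *: (1 : R)) - g c x)| < e.
  apply: finite_near => // c /Hg[dg vg].
  have : h^-1 *: ((g c \o shift x) (h *: (1 : R)) - g c x) @[h --> 0^'] --> l.
    by rewrite -vg; exact: dg.
  by move=> /cvgrPdist_lt/(_ e e0); rewrite near_withinE.
have shx : h *: (1 : R) + x @[h --> (0 : R)] --> x.
  rewrite -[X in _ --> X]add0r -[X in _ --> X + _](scale0r (1 : R)).
  by apply: cvgD; [apply: cvgZr_tmp; exact: cvg_id|exact: cvg_cst].
have near_G := shx _ HG.
rewrite near_withinE; near=> h => h0.
have [c Ic [/= -> ->]] : exists2 c, I c &
   G (h *: (1 : R) + x) = g c (h *: (1 : R) + x) /\ G x = g c x by near: h.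
by move: (c) Ic h0; near: h.
Unshelve. all: by end_near. Qed.

Lemma cvg_slice_x (p : R * R) : (t, p.2) @[t --> p.1] --> p.
Proof.
case: p => x y; apply: (@cvg_pair _ _ _ (nbhs x) (nbhs x) (nbhs y) _ _ _ id (fun=> y)).
  exact: cvg_id.
exact: cvg_cst.
Qed.

Lemma cvg_slice_y (p : R * R) : (p.1, t) @[t --> p.2] --> p.
Proof.
case: p => x y; apply: (@cvg_pair _ _ _ (nbhs y) (nbhs x) (nbhs y) _ _ _ (fun=> x) id).
  exact: cvg_cst.
exact: cvg_id.
Qed.

Lemma jet_field_derive_x C J j p : is_mesh C -> jet_spline C J -> interior (region C) p ->
  is_derive p.1 (1 : R) (fun x => J (x, p.2) 0 j) (J p 1 j).
Proof.
move=> m [A HA] pin; have pr := interior_subset pin.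
apply: (@derive_glue _ [set c | C c /\ in_cell c p] (fun c x => jet (A c) (x, p.2) 0 j)).
- by apply: sub_finite_set (mesh_finite m) => c [].
- by move=> c [cc cp]; rewrite (HA c) //; exact: derive_jet_x.
have sh := @cvg_slice_x p.
have N1 := sh _ (near_cells p m); have N2 := sh _ pin.
near=> x.
have [c cc cx] : region C (x, p.2) by near: x; exact: N2.
have cp : in_cell c p by move: (c) cc cx; near: x; exact: N1.
by exists c => //; rewrite -!surjective_pairing !(HA c).
Unshelve. all: by end_near. Qed.

Lemma jet_field_derive_y C J i p : is_mesh C -> jet_spline C J -> interior (region C) p ->
  is_derive p.2 (1 : R) (fun y => J (p.1, y) i 0) (J p i 1).
Proof.
move=> m [A HA] pin; have pr := interior_subset pin.
apply: (@derive_glue _ [set c | C c /\ in_cell c p] (fun c y => jet (A c) (p.1, y) i 0)).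
- by apply: sub_finite_set (mesh_finite m) => c [].
- by move=> c [cc cp]; rewrite (HA c) //; exact: derive_jet_y.
have sh := @cvg_slice_y p.
have N1 := sh _ (near_cells p m); have N2 := sh _ pin.
near=> y.
have [c cc cy] : region C (p.1, y) by near: y; exact: N2.
have cp : in_cell c p by move: (c) cc cy; near: y; exact: N1.
by exists c => //; rewrite -!surjective_pairing !(HA c).
Unshelve. all: by end_near. Qed.

Lemma inord_I2 : (inord 0 = 0 :> 'I_2) * (inord 1 = 1 :> 'I_2).
Proof. by split; apply: val_inj; rewrite /= inordK. Qed.

Lemma spline_of_jet C J s : is_mesh C -> jet_spline C J ->
  (forall p, region C p -> s p = J p 0 0) -> spline_space 3 3 1 1 C s.
Proof.
move=> m sJ sE; split.
  exists (fun i j p => J p (inord i) (inord j)); split.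
  - by move=> p pr; rewrite !inord_I2 sE.
  - by move=> i j _ _; exact: jet_field_continuous.
  - move=> [|//] j p _ _ pin; rewrite !inord_I2; exact: (jet_field_derive_x (inord j) m sJ pin).
  - move=> i [|//] p _ _ pin; rewrite !inord_I2; exact: (jet_field_derive_y (inord i) m sJ pin).
have [A HA] := sJ; move=> c cc; exists (A c) => p cp.
by rewrite -bicubicE /bicubic -HA // sE //; exists c.
Qed.

Lemma is_derive_unique (f : R -> R) (x l l' : R) :
  is_derive x (1 : R) f l -> is_derive x (1 : R) f l' -> l = l'.
Proof. by move=> [_ <-] [_ <-]. Qed.

Lemma interior_cell_region C c p : C c -> interior (in_cell c : set (R * R)) p ->
  interior (region C) p.
Proof. by move=> cc; apply: interiorS => q cq; exists c. Qed.

(** On the interior of a cell the given derivatives are those of the polynomial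
    piece, by uniqueness of derivatives; on the sides this follows by continuity.
    Hence the pieces share the jets given by the derivatives. *)
Lemma jet_of_spline C s : is_mesh C -> spline_space 3 3 1 1 C s ->
  exists2 J, jet_spline C J & forall p, region C p -> s p = J p 0 0.
Proof.
move=> m [[D [D0 Dc Dx Dy]] pol].
have /choice[A HA] : forall c, exists a, C c -> forall p, in_cell c p -> s p = bicubic a p.
  move=> c; have [cc|nc] := pselect (C c); last by exists 0.
  by have [a Ha] := pol c cc; exists a => _ p /Ha ->; rewrite bicubicE.
have I00 c p : C c -> in_cell c p -> D 0%N 0%N p = jet (A c) p 0 0.
  by move=> cc cp; rewrite D0 ?(HA c) //; exists c.
have nx c p : interior (in_cell c : set (R * R)) p ->
    \forall x \near p.1, interior (in_cell c : set (R * R)) (x, p.2).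
  by move=> ci; apply: (@cvg_slice_x p); apply: nbhs_interior.
have ny c p : interior (in_cell c : set (R * R)) p ->
    \forall y \near p.2, interior (in_cell c : set (R * R)) (p.1, y).
  by move=> ci; apply: (@cvg_slice_y p); apply: nbhs_interior.
have stepx c (j : nat) (j' : 'I_2) : C c -> (j <= 1)%N ->
    (forall p, interior (in_cell c : set (R * R)) p -> D 0%N j p = jet (A c) p 0 j') ->
    forall p, interior (in_cell c : set (R * R)) p -> D 1%N j p = jet (A c) p 1 j'.
  move=> cc j1 H p ci; have := Dx 0%N j p isT j1 (interior_cell_region cc ci).
  move=> h; apply: is_derive_unique h _.
  apply: near_eq_is_derive (derive_jet_x (A c) p j').
  by apply: filterS (nx c p ci) => x cx; rewrite -H.
have stepy c (i : nat) (i' : 'I_2) : C c -> (i <= 1)%N ->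
    (forall p, interior (in_cell c : set (R * R)) p -> D i 0%N p = jet (A c) p i' 0) ->
    forall p, interior (in_cell c : set (R * R)) p -> D i 1%N p = jet (A c) p i' 1.
  move=> cc i1 H p ci; have := Dy i 0%N p i1 isT (interior_cell_region cc ci).
  move=> h; apply: is_derive_unique h _.
  apply: near_eq_is_derive (derive_jet_y (A c) p i').
  by apply: filterS (ny c p ci) => y cy; rewrite -H.
have DJ c p (i j : 'I_2) : C c -> interior (in_cell c : set (R * R)) p -> D i j p = jet (A c) p i j.
  move=> cc ci; have D00 q : interior (in_cell c : set (R * R)) q -> D 0%N 0%N q = jet (A c) q 0 0.
    by move=> /interior_subset; exact: I00.
  have D10 := stepx c 0%N 0 cc isT D00; have D01 := stepy c 0%N 0 cc isT D00.
  have D11 := stepx c 1%N 1 cc isT D01.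
  by move: i j; apply: ord2P; apply: ord2P => /=; auto.
pose J p : 'M[R]_2 := \matrix_(i, j) D i j p.
exists J; last by move=> p pr; rewrite mxE D0.
exists A => c p cc cp; apply/matrixP => i j; rewrite mxE.
apply: contrapT => /eqP; rewrite -subr_eq0 -normr_gt0 => e0.
set e := `|_| in e0; have e2 : 0 < e / 2 by rewrite divr_gt0.
have i1 (k : 'I_2) : (k <= 1)%N by rewrite -ltnS ltn_ord.
have pr : region C p by exists c.
have /subspace_continuousP/(_ p pr)/cvgrPdist_lt/(_ _ e2) := Dc i j (i1 i) (i1 j).
rewrite near_withinE => N1.
have /cvgrPdist_lt/(_ _ e2) N2 := @continuous_jet (A c) p i j.
(* The centre q of a small rectangle near p is interior to c and has both jets
   close to those at p. *)
have [c0 [lx ly Hc0]] := small_box (mesh_lt m cc) cp (filterI N1 N2).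
pose q := (midpoint (side false c0), midpoint (side true c0)).
have q0 : in_cell c0 q.
  have /andP[h1 h2] := midpoint_inside (I := side false c0) lx.
  have /andP[h3 h4] := midpoint_inside (I := side true c0) ly.
  by rewrite /in_cell !ltW.
have [cq [q1 q2]] := Hc0 q q0.
have qi : interior (in_cell c : set (R * R)) q.
  apply/interior_cell => d.
  have [l1 _] := Hc0 (xlo c0, ylo c0) (corner_in (c := c0) (v := (xlo c0, ylo c0))
     (fun d => if d as b return (side b c0).1 < (side b c0).2 then ly else lx)
     (conj (or_introl erefl) (or_introl erefl))).
  have [l2 _] := Hc0 (xhi c0, yhi c0) (corner_in (c := c0) (v := (xhi c0, yhi c0))
     (fun d => if d as b return (side b c0).1 < (side b c0).2 then ly else lx)
     (conj (or_intror erefl) (or_intror erefl))).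
  have /andP[h1 h2] := midpoint_inside (I := side false c0) lx.
  have /andP[h3 h4] := midpoint_inside (I := side true c0) ly.
  move/in_cellP: l1 => /(_ d)/andP[a1 _]; move/in_cellP: l2 => /(_ d)/andP[_ a2].
  by case: d a1 a2 => /= a1 a2; [rewrite (le_lt_trans a1) ?(lt_le_trans _ a2)|
     rewrite (le_lt_trans a1) ?(lt_le_trans _ a2)].
have qr : region C q by exists c.
have {}q1 := q1 qr.
have E : D i j q = jet (A c) q i j := DJ c q i j cc qi.
rewrite -[X in `|X|]/(D i j p - D i j q) in q1.
have : e < e / 2 + e / 2.
  rewrite {1}/e (_ : _ - _ = (D i j p - D i j q) - (jet (A c) p i j - jet (A c) q i j)).
    by apply: le_lt_trans (ler_normB _ _) _; apply: ltrD.
  by rewrite E; ring.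
by rewrite -splitr ltxx.
Qed.

(** * The block of cells around a basis vertex and its B-splines *)

Section Block.
Variables (M : set (cell R)) (v : R * R).
Hypotheses (mM : is_mesh M) (fv : full_vertex M v).
Implicit Types (l r : bool -> R).

Definition cell_of_sides (I : bool -> R * R) : cell R :=
  Cell (I false).1 (I false).2 (I true).1 (I true).2.

Lemma side_cell_of_sides I d : side d (cell_of_sides I) = I d.
Proof. by case: d; rewrite /= -surjective_pairing. Qed.

(** The block condition on the cells around v, with the two directions treated
    alike; l and r give the outer knots. *)
Definition block l r : Prop :=
  [/\ forall d, l d <= coordinate d v <= r d, exists2 c, M c & in_cell c v
    & forall c, M c /\ in_cell c v <-> forall d,
       (side d c = (l d, coordinate d v) \/ side d c = (coordinate d v, r d)) /\
       (side d c).1 < (side d c).2].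

Lemma vertex_blockP sl sr tl tr : vertex_block M v sl sr tl tr <->
  block (fun d => if d then tl else sl) (fun d => if d then tr else sr).
Proof.
split=> -[h1 h2 h3].
  move=> h4; split=> //; first by case.
  move=> c; rewrite h4; split; first by case=> a1 a2 a3 a4 [].
  by move=> H; split; have [[a1|a1] a2] := H false; have [[a3|a3] a4] := H true; tauto.
split=> //; [exact: (h1 false)|exact: (h1 true)|].
move=> c; rewrite h3; split; last by case=> a1 a2 a3 a4 [].
by move=> H; split; have [[a1|a1] a2] := H false; have [[a3|a3] a4] := H true; tauto.
Qed.

(** A cell of the block can be built from any one cell containing v by exchanging
    its side in direction d. *)
Lemma block_left l r d : block l r ->
  l d < coordinate d v -> half_open false (side d domain) (coordinate d v) /\
  exists c, [/\ M c, in_cell c v & side d c = (l d, coordinate d v)].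
Proof.
move=> [_ [c0 c0M c0v] H] lv; have H0 := (H c0).1 (conj c0M c0v).
pose c := cell_of_sides (fun d' => if d' == d then (l d, coordinate d v) else side d' c0).
have [cM cv] : M c /\ in_cell c v.
  apply/H => d'; rewrite side_cell_of_sides; case: eqP => [->|_]; last exact: H0.
  by split; [left|].
have sc : side d c = (l d, coordinate d v) by rewrite side_cell_of_sides eqxx.
split; last by exists c.
by apply: half_open_sub (mesh_sub mM cM d) _; rewrite sc /= lv lexx.
Qed.

Lemma block_right l r d : block l r ->
  coordinate d v < r d -> half_open true (side d domain) (coordinate d v) /\
  exists c, [/\ M c, in_cell c v & side d c = (coordinate d v, r d)].
Proof.
move=> [_ [c0 c0M c0v] H] rv; have H0 := (H c0).1 (conj c0M c0v).
pose c := cell_of_sides (fun d' => if d' == d then (coordinate d v, r d) else side d' c0).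
have [cM cv] : M c /\ in_cell c v.
  apply/H => d'; rewrite side_cell_of_sides; case: eqP => [->|_]; last exact: H0.
  by split; [right|].
have sc : side d c = (coordinate d v, r d) by rewrite side_cell_of_sides eqxx.
split; last by exists c.
by apply: half_open_sub (mesh_sub mM cM d) _; rewrite sc /= rv lexx.
Qed.

(** A side of the block is missing only at the boundary of the domain. *)
Lemma block_half_open l r d s : block l r -> half_open s (side d domain) (coordinate d v) ->
  if s then coordinate d v < r d else l d < coordinate d v.
Proof.
move=> [_ _ H] hs; have [t ht] : exists t, half_open t (side (~~ d) domain) (coordinate (~~ d) v).
  by apply: half_open_exists (domain_lt _) _; move/in_cellP: fv.1; exact.
have [c cM q] := mesh_cover mM (in_quadrant_dirs hs ht).
have := q d; rewrite /dirs eqxx; have [[->|->] /= h2] := (H c).1 (conj cM (in_quadrant_cell q)) d.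
  by case: (s) => //=; rewrite ltxx andbF.
by case: (s) => //=; rewrite ltxx.
Qed.

Lemma block_lt l r d : block l r -> l d < r d.
Proof.
move=> bl; have [h _ _] := bl; have /andP[h1 h2] := h d.
have [s hs] : exists s, half_open s (side d domain) (coordinate d v).
  by apply: half_open_exists (domain_lt _) _; move/in_cellP: fv.1; exact.
have := block_half_open bl hs; case: (s) => h3; first exact: le_lt_trans h3.
exact: lt_le_trans h2.
Qed.

Lemma block_unique l r l' r' : block l r -> block l' r' -> l = l' /\ r = r'.
Proof.
move=> b b'; have [k _ H] := b; have [k' _ H'] := b'; split; apply/funext => d.
  have [lt|] := ltP (l d) (coordinate d v).
    have [_ [c [cM cv sc]]] := block_left b lt.
    have := ((H' c).1 (conj cM cv) d).1; rewrite sc => -[[]//|[e _]].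
    by rewrite e ltxx in lt.
  have [lt _|h h'] := ltP (l' d) (coordinate d v).
    have [_ [c [cM cv sc]]] := block_left b' lt.
    have := ((H c).1 (conj cM cv) d).1; rewrite sc => -[[]//|[e _]].
    by rewrite e ltxx in lt.
  have /andP[a1 _] := k d; have /andP[a2 _] := k' d.
  by transitivity (coordinate d v); apply/eqP; rewrite eq_le ?h ?h' ?a1 ?a2.
have [lt|] := ltP (coordinate d v) (r d).
  have [_ [c [cM cv sc]]] := block_right b lt.
  have := ((H' c).1 (conj cM cv) d).1; rewrite sc => -[[_ e]|[]//].
  by rewrite e ltxx in lt.
have [lt _|h h'] := ltP (coordinate d v) (r' d).
  have [_ [c [cM cv sc]]] := block_right b' lt.
  have := ((H c).1 (conj cM cv) d).1; rewrite sc => -[[_ e]|[]//].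
  by rewrite e ltxx in lt.
have /andP[_ a1] := k d; have /andP[_ a2] := k' d.
by transitivity (coordinate d v); apply/eqP; rewrite eq_le ?h ?h' ?a1 ?a2.
Qed.

(** Cells at v that lie on the same side of v in direction d have the same extent
    in that direction. *)
Definition aligned := forall c c' d s, M c -> M c' -> in_cell c v -> in_cell c' v ->
  coordinate d v = near_end s (side d c) -> coordinate d v = near_end s (side d c') ->
  side d c = side d c'.

(** The outer knot on either side is the common far end of the cells there, or the
    coordinate of v itself if there are none. *)
Lemma block_exists : aligned -> exists l r, block l r.
Proof.
move=> al.
have E (s d : bool) : exists x, (if s then coordinate d v <= x else x <= coordinate d v) /\
   ((exists c, [/\ M c, in_cell c v & side d c = if s then (coordinate d v, x) else (x,
     coordinate d v)]) \/
    (x = coordinate d v /\ forall c, M c -> in_cell c v ->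
      coordinate d v <> near_end s (side d c))).
  have [[c [cM cv e]]|no] := pselect (exists c, [/\ M c,
    in_cell c v & coordinate d v = near_end s (side d c)]).
    exists (near_end (~~ s) (side d c)); have := mesh_lt mM cM d.
    split; first by rewrite e; case: (s) => /=; exact: ltW.
    left; exists c; split=> //; rewrite e [LHS]surjective_pairing; by case: (s).
  exists (coordinate d v); split; first by case: (s).
  by right; split=> // c cM cv e; apply: no; exists c.
have /choice[l Hl] := E false; have /choice[r Hr] := E true.
exists l, r; split.
- by move=> d; have [/= -> _] := Hl d; have [/= -> _] := Hr d.
- have [s q] := in_cell_quadrant domain_lt fv.1; have [c cM cq] := mesh_cover mM q.
  by exists c => //; exact: in_quadrant_cell cq.
move=> c; split=> [[cM cv] d|H].
  split; last exact: (mesh_lt mM cM).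
  have cor := fv.2 c cM cv; move/cornerP: (cor) => /(_ d)[e|e]; [right|left].
    have [_ [[c' [cM' cv' e']]|[_ /(_ c cM cv)]]] := Hr d; last by case.
    by rewrite -e'; apply: (al c c' d true) => //; rewrite e'.
  have [_ [[c' [cM' cv' e']]|[_ /(_ c cM cv)]]] := Hl d; last by case.
  by rewrite -e'; apply: (al c c' d false) => //; rewrite e'.
(* A product of two admissible intervals is a cell: look for the cell of the mesh in
   the same quadrant at v. *)
have Hd d : exists s, half_open s (side d domain) (coordinate d v) /\
  near_end s (side d c) = coordinate d v /\
  (exists c', [/\ M c', in_cell c' v & side d c' = side d c]).
  have [[e|e] lt] := H d; rewrite e /= in lt.
    have [_ [[c' [cM cv e']]|[x _]]] := Hl d; last by rewrite x ltxx in lt.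
    exists false; rewrite e /=; split; last by split=> //; exists c'.
    by apply: (@half_open_sub false _ _ _ (mesh_sub mM cM d)); rewrite e' /= lt lexx.
  have [_ [[c' [cM cv e']]|[x _]]] := Hr d; last by rewrite x ltxx in lt.
  exists true; rewrite e /=; split; last by split=> //; exists c'.
  by apply: (@half_open_sub true _ _ _ (mesh_sub mM cM d)); rewrite e' /= lt lexx.
have /choice[s Hs] := Hd.
have [c' cM q] := mesh_cover mM (fun d => (Hs d).1).
have c'v := fv.2 c' cM (in_quadrant_cell q).
suff -> : c = c' by split=> //; exact: in_quadrant_cell q.
apply: cell_eq => d; have [_ [ne [c2 [c2M c2v e2]]]] := Hs d; rewrite -e2.
apply: (al c2 c' d (s d)) => //; first exact: in_quadrant_cell q.
  by rewrite e2 ne.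
exact: in_quadrant_near_end c'v q d.
Qed.

Lemma block_side e l r c d : block l r -> M c -> in_cell c v ->
  exists u : 'cV[R]_4,
   [/\ forall x, (side d c).1 <= x <= (side d c).2 ->
         bspline (local_knots e (l d) (coordinate d v) (r d)) 3 0 x = (jet1 x *m u) 0 0
     & forall w, at_end d c w -> jet1 (coordinate d w) *m u =
         if coordinate d w == coordinate d v then knot_jet e (l d) (coordinate d v) (r d) else 0].
Proof.
move=> [k _ H] cM cv; have /andP[k1 k2] := k d.
have [[s|s] lt] := (H c).1 (conj cM cv) d; rewrite /at_end s /= in lt *.
  have [u [h1 h2 h3]] := bspline_left e lt k2; exists u; split=> // w [] ->.
    by rewrite h2 lt_eqF.
  by rewrite h3 eqxx.
have [u [h1 h2 h3]] := bspline_right e k1 lt; exists u; split=> // w [] ->.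
  by rewrite h2 eqxx.
by rewrite h3 gt_eqF.
Qed.

(** Wherever the univariate B-spline is nonzero, the half-open interval around x
    pointing in a direction that stays in the domain lies in the block. *)
Lemma block_meet e l r c s d x : block l r -> M c -> half_open s (side d c) x ->
  bspline (local_knots e (l d) (coordinate d v) (r d)) 3 0 x != 0 ->
  exists I, [/\ I = (l d, coordinate d v) \/ I = (coordinate d v, r d),
    I.1 < I.2 & half_open s I x].
Proof.
move=> bl cM hx nz; have [k _ H] := bl.
have [/andP[x1 x2] xl xr] := bspline_supp (k d) (block_lt d bl) nz.
suff [I [h1 h2]] : exists I, (I = (l d, coordinate d v) \/
  I = (coordinate d v, r d)) /\ half_open s I x.
  by exists I; split=> //; exact: half_open_lt h2.
have hD := half_open_sub (mesh_sub mM cM d) hx.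
case: s hD {hx} => hD /=.
  have [xv|vx] := ltP x (coordinate d v); first by exists (l d, coordinate d v); split;
    [left|rewrite /= x1].
  exists (coordinate d v, r d); split; first by right.
  rewrite /= vx lt_neqAle x2 andbT; apply/eqP => e'; have e2 := xr e'.
  by move: hD; rewrite e' -e2 => /(block_half_open bl); rewrite -e2 ltxx.
have [vx|xv] := ltP (coordinate d v) x; first by exists (coordinate d v, r d); split;
  [right|rewrite /= vx].
exists (l d, coordinate d v); split; first by left.
rewrite /= xv andbT lt_neqAle x1 andbT; apply/eqP => e'; have e2 := xl (esym e').
by move: hD; rewrite -e' e2 => /(block_half_open bl); rewrite e2 ltxx.
Qed.

(** The jets, at the vertices of the mesh, of the B-spline of v with flags e. *)
Definition spike (e : bool * bool) l r (w : R * R) : 'M[R]_2 :=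
  if w == v then knot_jet e.1 (l false) v.1 (r false) *m (knot_jet e.2 (l true) v.2 (r true))^T
  else 0.

(** On a cell of the block the B-spline is a product of two cubics with the
    right end jets.  A cell not containing v meets the support in no half-open
    quadrant, because there the block already has a cell, and cells do not
    overlap. *)
Lemma vertex_bspline_jet e l r c p : block l r -> M c -> in_cell c p ->
  vertex_bspline e.1 e.2 (l false) (r false) (l true) (r true) v p =
  jet (hermite c (spike e l r)) p 0 0.
Proof.
move=> bl cM cp; rewrite /vertex_bspline.
have [cv|ncv] := pselect (in_cell c v).
  have [u [u1 u2]] := block_side e.1 false bl cM cv.
  have [u' [u1' u2']] := block_side e.2 true bl cM cv.
  have -> : jet (hermite c (spike e l r)) p = jet (u *m u'^T) p.
    apply: (jet_corners cp) => w cw; rewrite (jet_hermite_corner _ mM cM) //.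
    move/cornerP: (cw) => ew; rewrite jet_outer (u2 w (ew false)) (u2' w (ew true)) /spike /=.
    have -> : (w == v) = (w.1 == v.1) && (w.2 == v.2) by [].
    case: eqP => _; last by rewrite mul0mx.
    by case: eqP => _ //; rewrite linear0 mulmx0.
  rewrite jet_outer mxE big_ord1 !mxE.
  move/in_cellP: cp => ip; rewrite (u1 _ (ip false)) (u1' _ (ip true)).
  by rewrite !mxE.
have -> : jet (hermite c (spike e l r)) p = 0.
  rewrite -(jet0 p); apply: (jet_corners cp) => w cw.
  rewrite (jet_hermite_corner _ mM cM) // jet0 /spike; case: eqP => // wv; exfalso.
  by apply: ncv; rewrite -wv; exact: corner_in (mesh_lt mM cM) cw.
rewrite mxE; apply/eqP; apply: contrapT => /negP; rewrite mulf_eq0 negb_or => /andP[n1 n2].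
have [s q] := mesh_in_cell_quadrant mM cM cp.
(* If the value is nonzero, some cell of the block contains the same half-open
   quadrant at p as c does. *)
have [I [I1 I2 I3]] := block_meet (e := e.1) (d := false) bl cM (q false) n1.
have [K [K1 K2 K3]] := block_meet (e := e.2) (d := true) bl cM (q true) n2.
pose c' := cell_of_sides (fun d => if d then K else I).
have [c'M c'v] : M c' /\ in_cell c' v.
  by have [_ _ H] := bl; apply/H => d; rewrite side_cell_of_sides; case: d.
apply: ncv; suff -> : c = c' by [].
by apply: (mesh_unique mM cM c'M q) => d; rewrite side_cell_of_sides; case: d.
Qed.

End Block.

(** * One refinement step *)

Definition part_in_direction (d : bool) (h : part * part) : part := if d then h.2 else h.1.

Definition splits (y : subdivision) (d : bool) : bool :=
  match y with Cross => true | Horizontal => d | Vertical => ~~ d end.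

Lemma side_subcell d h c : side d (subcell h c) = part_interval (part_in_direction d h) (side d c).
Proof. by case: d. Qed.

Lemma piecesP y h : pieces y h <->
  forall d, if splits y d then exists b : bool, part_in_direction d h = if b then Upper else Lower
            else part_in_direction d h = Whole.
Proof.
have E q : q <> Whole <-> exists b : bool, q = if b then Upper else Lower.
  by case: q; split=> //; [case=> -[]|exists false|exists true].
split=> [H d|H].
  case: y H => /= -[h1 h2]; case: d => //=; exact/E.
have H0 := H false; have H1 := H true; move: H0 H1 => {H}; case: y => /= H0 H1; split=> //; exact/E.
Qed.

Lemma finite_parts : finite_set [set: part].
Proof.
have -> : [set: part] = [set Whole] `|` [set Lower] `|` [set Upper].
  by apply/seteqP; split=> // -[] _; [left; left|left; right|right].
by rewrite !finite_setU; split; [split|]; exact: finite_set1.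
Qed.

Section Step.
Variables (C Th : set (cell R)) (ty : cell R -> subdivision).
Hypotheses (m : is_mesh C) (ThC : Th `<=` C).

Definition pieces_of : set (cell R) :=
  [set c | exists t h, [/\ Th t, pieces (ty t) h & c = subcell h t]].

Definition subdivided : set (cell R) := (C `\` Th) `|` pieces_of.

(** Every cell of the new mesh is a piece of a cell of the old one, possibly the
    whole of it. *)
Lemma parent_cell c : subdivided c -> exists2 t, C t &
  (forall d, subinterval (side d c) (side d t)) /\
  ((~ Th t /\ c = t) \/ (Th t /\ exists2 h, pieces (ty t) h & c = subcell h t)).
Proof.
case=> [[cc nt]|[t [h [tt ph ->]]]].
  by exists c => //; split; [move=> d; rewrite /subinterval !lexx|left].
exists t; first exact: ThC.
split; last by right; split=> //; exists h.
by move=> d; rewrite side_subcell; apply: (part_interval_sub _ _).1; apply: (mesh_lt m (ThC tt)).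
Qed.

(** A half-open interval is partitioned by its half-open halves. *)
Lemma subdivided_mesh : is_mesh subdivided.
Proof.
split.
- rewrite finite_setU; split.
    by apply: sub_finite_set (mesh_finite m) => c [].
  have fT := sub_finite_set ThC (mesh_finite m).
  have := finite_image (fun x => subcell x.2 x.1) (finite_setX fT (finite_setX finite_parts finite_parts)).
  by apply: sub_finite_set => c [t [[h1 h2] [tt _ ->]]]; exists (t, (h1, h2)).
- move=> c d [[cc _]|[t [h [tt ph ->]]]]; first exact: (mesh_dyadic m).
  have [n dn] := mesh_dyadic m d (ThC tt); rewrite side_subcell.
  have := (piecesP _ _).1 ph d; case: (splits _ d) => [[b ->]|->].
    by exists n.+1; exact: (dyadic_half b dn).
  by exists n; rewrite part_interval_Whole.
- move=> s p /(mesh_cover m)[c cc q].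
  have [ct|nct] := pselect (Th c); last by exists c => //; left.
  have hd d : exists k, half_open (s d) (part_interval k (side d c)) (coordinate d p) /\
     if splits (ty c) d then exists b : bool, k = if b then Upper else Lower else k = Whole.
    case: (splits _ d); last by exists Whole; rewrite part_interval_Whole; split => //; exact: q.
    have [b hb] := half_open_half (q d); exists (if b then Upper else Lower).
    by split=> //; exists b.
  have [h0 [q0 p0]] := hd false; have [h1 [q1 p1]] := hd true.
  exists (subcell (h0, h1) c); last by case; rewrite side_subcell.
  by right; exists c, (h0, h1); split=> //; apply/piecesP => -[].
move=> s p c c' cc c'c q q'.
have [t tC [ts tt]] := parent_cell cc; have [t' tC' [ts' tt']] := parent_cell c'c.
have E : t = t'.
  by apply: (mesh_unique m tC tC' (s := s) (p := p)) => d;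
     [exact: half_open_sub (ts d) (q d)|exact: half_open_sub (ts' d) (q' d)].
subst t'; case: tt => [[n ->]|[y [h ph eh]]]; case: tt' => [[n' ->]|[y' [h' ph' eh']]] //.
rewrite eh eh' in q q' *; congr subcell; apply: (can_inj (g := fun f =>
  (f false, f true)) (f := fun h d => part_in_direction d h)).
  by case.
apply/funext => d; have := q d; have := q' d; rewrite !side_subcell.
have := (piecesP _ _).1 ph d; have := (piecesP _ _).1 ph' d.
case: (splits _ d) => [[b ->] [b' ->] h1 h2|-> -> //].
by rewrite (half_open_half_inj h1 h2).
Qed.

(** The form in which the condition on T-vertices is used: a T-vertex is a vertex
    but not a basis vertex, and it may not become one. *)
Hypothesis no_promotion : forall v,
  full_vertex subdivided v -> ~ full_vertex C v -> ~ vertex C v.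

Definition new_vertex v : Prop := full_vertex subdivided v /\ ~ full_vertex C v.

Let m' := subdivided_mesh.

Lemma full_vertex_subdivided v : full_vertex C v -> full_vertex subdivided v.
Proof.
move=> [vd F]; split=> // c cc cv; have [t tC [ts _]] := parent_cell cc.
exact: subinterval_corner ts cv (F t tC (subinterval_in_cell ts cv)).
Qed.

Lemma corner_not_new t v : C t -> corner t v -> ~ new_vertex v.
Proof. by move=> tC tv [f nf]; apply: (no_promotion f nf); exists t. Qed.

(** Let c and c' be pieces of t and t', with v as an end in direction d on the
    same side.  Inside one cell t = t' both are the same half or both undivided.
    Otherwise v is strictly inside the sides of t and t' in direction d, thus their
    common midpoint, and dyadic intervals with the same midpoint are equal. *)
Lemma new_vertex_aligned v c c' d s : new_vertex v -> subdivided c -> subdivided c' ->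
  in_cell c v -> in_cell c' v -> coordinate d v = near_end s (side d c) ->
  coordinate d v = near_end s (side d c') -> side d c = side d c'.
Proof.
move=> [fv nfv] cc c'c cv c'v e e'; have nv := no_promotion fv nfv.
have cor := fv.2 _ cc cv; have cor' := fv.2 _ c'c c'v.
have [t tC [ts tt]] := parent_cell cc; have [t' tC' [ts' tt']] := parent_cell c'c.
have [tth [h ph eh]] : Th t /\ exists2 h, pieces (ty t) h & c = subcell h t.
  by case: tt => // -[_ ect]; exfalso; apply: nv; exists t => //; rewrite -ect.
have [tth' [h' ph' eh']] : Th t' /\ exists2 h, pieces (ty t') h & c' = subcell h t'.
  by case: tt' => // -[_ ect]; exfalso; apply: nv; exists t' => //; rewrite -ect.
have lt := mesh_lt m tC d; have lt' := mesh_lt m tC' d.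
have [E|tne] := pselect (t = t').
  subst t'; move: e e'; rewrite eh eh' !side_subcell.
  have := (piecesP _ _).1 ph d; have := (piecesP _ _).1 ph' d.
  case: (splits _ d) => [[b ->] [b' ->] -> /(half_interval_near_inj lt) ->|-> ->] //.
(* Different cells on the same side of v in direction d are separated by a line through
   v in that direction; if v were also at an end of one of them, it would be a corner. *)
have strict (a b : cell R) : C a -> C b -> a <> b -> half_open s (side d a) (coordinate d v) ->
    half_open s (side d b) (coordinate d v) -> in_cell a v -> in_cell b v ->
    (side d a).1 < coordinate d v < (side d a).2.
  move=> aC bC ab ha hb av bv; have [ea|//] := at_end_or_inside d av; exfalso.
  have sa : (side (~~ d) a).1 < coordinate (~~ d) v < (side (~~ d) a).2.
    have [ea'|//] := at_end_or_inside (~~ d) av; exfalso; apply: nv; exists a => //.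
    by apply/cornerP => d'; case: d d' ea ea' {e e' lt lt' ha hb} => [] [].
  have [r hr] : exists r, half_open r (side (~~ d) b) (coordinate (~~ d) v).
    by apply: half_open_exists (mesh_lt m bC _) _; move/in_cellP: bv; exact.
  by apply: ab; apply: (mesh_unique m aC bC (in_quadrant_dirs ha (half_open_inside r sa))
    (in_quadrant_dirs hb hr)).
have ht : half_open s (side d t) (coordinate d v).
  by apply: half_open_sub (ts d) _; rewrite e; apply: half_open_near_end; exact: (mesh_lt m' cc).
have ht' : half_open s (side d t') (coordinate d v).
  by apply: half_open_sub (ts' d) _; rewrite e'; apply: half_open_near_end; exact: (mesh_lt m' c'c).
have tv := subinterval_in_cell ts cv; have tv' := subinterval_in_cell ts' c'v.
have st := strict _ _ tC tC' tne ht ht' tv tv'.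
have st' := strict _ _ tC' tC (nesym tne) ht' ht tv' tv.
rewrite e eh side_subcell in st; rewrite e' eh' side_subcell in st'.
have [m1 e1] := part_interval_near_midpoint st; have [m2 e2] := part_interval_near_midpoint st'.
rewrite eh eh' !side_subcell e1 e2.
have [n dn] := mesh_dyadic m d tC; have [n' dn'] := mesh_dyadic m d tC'.
congr half_interval; apply: dyadic_mid_eq (sorted_grid d) dn dn' _.
by rewrite -m1 -m2 -!side_subcell -eh -eh' -e -e'.
Qed.

(** If w is interior to c, then c is the only cell at w, and w is no vertex.
    Otherwise suppose that v is new and an end of the edge of c through w.  The cell
    c2 with corner w and the neighbour c3 of c at v on the side of c2 both contain
    the quadrant at w in which c2 lies, because c3 extends along the edge as far as
    c does.  So c2 = c3, which has w strictly inside its side. *)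
Lemma new_vertex_not_on_face c v w : subdivided c -> vertex subdivided w -> in_cell c w ->
  corner c v ->
  (forall d, at_end d c w -> coordinate d v = coordinate d w) -> w <> v -> ~ new_vertex v.
Proof.
move=> cc [c2 cc2 w2] cw cv fw wv nv.
have [d dne] : exists d, coordinate d w <> coordinate d v.
  apply: contrapT => H; apply: wv; rewrite [w]surjective_pairing [v]surjective_pairing.
  by congr pair; apply: contrapT => h; apply: H; [exists false|exists true].
have st : (side d c).1 < coordinate d w < (side d c).2.
  by have [e|//] := at_end_or_inside d cw; exfalso; apply: dne; rewrite fw.
have [s q] := mesh_in_cell_quadrant m' cc2 (corner_in (mesh_lt m' cc2) w2).
have [e'|st'] := at_end_or_inside (~~ d) cw; last first.
  have E : c2 = c.
    apply: (mesh_unique m' cc2 cc q) => d'; apply: half_open_inside.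
    by case: d d' st st' {dne} => [] [].
  by subst c2; move/cornerP: w2 => /(_ d); exact: inside_not_at_end.
have cv' := corner_in (mesh_lt m' cc) cv.
have [t ht] : exists t, half_open t (side d c) (coordinate d v).
  by apply: half_open_exists (mesh_lt m' cc d) _; move/in_cellP: cv'; exact.
(* The direction t points from v along the face; transversally take the side of c2. *)
have [c3 cc3 q3] : exists2 c3, subdivided c3 & in_quadrant (dirs d t (s (~~ d))) c3 v.
  apply: (mesh_cover m'); apply: in_quadrant_dirs; first exact: half_open_sub (mesh_sub m' cc d) ht.
  by rewrite fw //; exact: half_open_sub (mesh_sub m' cc2 _) (q _).
have c3v := nv.1.2 _ cc3 (in_quadrant_cell q3).
have E : side d c3 = side d c.
  apply: (new_vertex_aligned (s := t) nv cc3 cc (in_quadrant_cell q3) cv').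
    by have := in_quadrant_near_end c3v q3 d; rewrite /dirs eqxx.
  by apply: half_open_end ht; move/cornerP: cv; exact.
have E3 : c3 = c2.
  apply: (mesh_unique m' cc3 cc2 _ q) => d'; have [->|ne] := eqVneq d' d.
    by apply: half_open_inside; rewrite E.
  have -> : d' = ~~ d by case: d d' ne {dne st E ht e' q3} => [] [].
  have := q3 (~~ d); rewrite fw // /dirs ifF //; by case: (d).
by subst c3; move/cornerP: w2 => /(_ d); apply: inside_not_at_end; rewrite E.
Qed.

(** Where a vertex w of the new mesh lies inside a side of a cell c, no corner of
    the face of c through w is new.  There the prescribed jets are those of J, and
    since J is bicubic on the parent of c, the interpolant reproduces J at w. *)
Lemma refine_jet_spline J D : jet_spline C J ->
  (forall v, vertex subdivided v -> ~ new_vertex v -> D v = J v) ->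
  exists2 K, jet_spline subdivided K &
    (forall c p, subdivided c -> in_cell c p -> K p = jet (hermite c D) p) /\
    forall v, vertex subdivided v -> K v = D v.
Proof.
move=> [A HA] HD.
have H c w : subdivided c -> in_cell c w -> vertex subdivided w -> jet (hermite c D) w = D w.
  move=> cc cw vw; have [cw'|ncw] := pselect (corner c w).
    exact: jet_hermite_corner m' cc cw'.
  rewrite HD //; last by case=> -[_ /(_ c cc cw)].
  have [t tC [ts _]] := parent_cell cc; rewrite (HA t) //; last exact: subinterval_in_cell cw.
  apply: (jet_face cw) => v cv fv; rewrite (jet_hermite_corner _ m' cc) //.
  have vw' : v <> w by move=> e; subst v.
  have cv' := corner_in (mesh_lt m' cc) cv.
  rewrite HD; [|by exists c|exact: new_vertex_not_on_face vw cw cv fv (nesym vw')].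
  by apply: HA => //; exact: subinterval_in_cell cv'.
have [K sK HK] := jet_spline_glue m' H.
exists K => //; split=> // v vv; have [c cc cv] := vv.
by have cv' := corner_in (mesh_lt m' cc) cv; rewrite (HK c) // H.
Qed.

Definition reset_jets J (v : R * R) : 'M[R]_2 := if `[< new_vertex v >] then 0 else J v.

Lemma refine_reset_jets J : jet_spline C J -> exists2 K, jet_spline subdivided K &
  (forall c p, subdivided c -> in_cell c p -> K p = jet (hermite c (reset_jets J)) p) /\
  forall v, vertex subdivided v -> K v = reset_jets J v.
Proof. by move=> sJ; apply: (refine_jet_spline sJ) => v _ nv; rewrite /reset_jets asboolF. Qed.

(** The de Casteljau scheme reproduces the polynomial on the piece; after that
    the erased ordinates and the erased jets correspond. *)
Lemma modify_piece t h b a V J : Th t -> pieces (ty t) h ->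
  (forall p, in_cell t p -> b p = bicubic a p) ->
  (forall p, in_cell t p -> J p = jet a p) ->
  jet (bezier_coef (subcell h t) (zero_at V (subcell h t) (subcell_ordinates h (ordinates b t))))
  =1 jet (hermite (subcell h t) (fun v => if `[< V v >] then 0 else J v)).
Proof.
move=> tt ph ba Ja; set c := subcell h t.
have tC := ThC tt; have lt := mesh_lt m tC.
have cc : subdivided c by right; exists t, h.
have lc := mesh_lt m' cc.
have st d : subinterval (side d c) (side d t) by rewrite side_subcell;
  exact: (part_interval_sub _ (lt d)).1.
have ea : bezier_coef c (subcell_ordinates h (ordinates b t)) = a.
  apply: (bicubic_inj lc) => q cq; rewrite -(bezier_bicubic _ _ (lc false) (lc true)).
  rewrite (bezier_subcell h _ _ (lt false) (lt true)).
  have tq := subinterval_in_cell st cq.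
  by rewrite -(ordinatesP (lt false) (lt true) ba tq) ba.
have E : bezier_coef c (zero_at V c (subcell_ordinates h (ordinates b t))) =
   hermite c (fun v => if `[< V v >] then 0 else J v).
  apply: (bicubic_inj lc) => q cq; rewrite /bicubic; congr (fun_of_matrix _ 0 0).
  apply: (jet_corners cq) => v cv; rewrite (jet_hermite_corner _ m' cc) //.
  have vt := subinterval_in_cell st (corner_in lc cv).
  have [k [k' e]] := corner_ofP cv; subst v; rewrite (jet_zero_at _ _ _ _ (lc false) (lc true)) ea.
  by case: asboolP => // _; rewrite Ja.
by move=> p; rewrite E.
Qed.

(** The value picked by the modification operator does not depend on the piece
    it is picked from, because all of them are values of the one field K.  A cell on
    which b is not modified either is not subdivided, and then has no new corner,
    or does not lie in the support of b, and then b vanishes on it. *)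
Lemma modify_value V b J K : V =1 new_vertex ->
  jet_spline C J -> (forall p, region C p -> b p = J p 0 0) ->
  (forall c p, subdivided c -> in_cell c p -> K p = jet (hermite c (reset_jets J)) p) ->
  forall p, region subdivided p -> modify Th ty V b p = K p 0 0.
Proof.
move=> VE [A HA] bJ HK p [c cc cp].
have bA t : C t -> forall q, in_cell t q -> b q = bicubic (A t) q.
  by move=> tC q tq; rewrite bJ /bicubic -?HA //; exists t.
have VE' : (fun v => if `[< V v >] then 0 else J v) = reset_jets J.
  by apply/funext => v; rewrite /reset_jets VE.
rewrite /modify; case: xgetP => [y _ [t [h [tt _ ph hp yE]]]|no].
  have cc' : subdivided (subcell h t) by right; exists t, h.
  have lc := mesh_lt m' cc'; rewrite yE (bezier_bicubic _ _ (lc false) (lc true)).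
  rewrite /bicubic (modify_piece _ tt ph (bA _ (ThC tt)) (J := J)); last first.
    by move=> q tq; apply: HA => //; exact: ThC.
  by rewrite VE' -HK.
have [t tC [ts tt]] := parent_cell cc; have tp := subinterval_in_cell ts cp.
rewrite (bA t tC _ tp) (HK c p cc cp) /bicubic; congr (fun_of_matrix _ 0 0).
have [E|nE] := pselect (c = t).
  rewrite -E; apply: (jet_corners cp) => v cv; rewrite (jet_hermite_corner _ m' cc) //.
  rewrite E in cv *; rewrite /reset_jets asboolF; last exact: corner_not_new cv.
  by rewrite (HA t) //; exact: corner_in (mesh_lt m tC) cv.
have [tt' [h ph eh]] : Th t /\ exists2 h, pieces (ty t) h & c = subcell h t.
  by case: tt => // -[_ /nE].
(* Otherwise b would have been modified on t. *)
have At : A t = 0.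
  apply: contrapT => /eqP nz; have sb := supp_cell (mesh_lt m tC) nz (bA t tC).
  by apply: (no _); exists t, h; split; [| | |rewrite -eh|reflexivity].
rewrite At jet0 -(jet0 p); apply: (jet_corners cp) => v cv.
rewrite jet0 (jet_hermite_corner _ m' cc) // /reset_jets; case: asboolP => // _.
by rewrite (HA t) ?At ?jet0 //; apply: (subinterval_in_cell ts);
  exact: corner_in (mesh_lt m' cc) cv.
Qed.

(** An undivided cell around a new basis vertex would have it as a corner, so the
    vertex would belong to the old mesh. *)
Lemma new_vertex_blockE v l r : new_vertex v -> block pieces_of v l r <-> block subdivided v l r.
Proof.
move=> nv; have E c : (subdivided c /\ in_cell c v) <-> (pieces_of c /\ in_cell c v).
  split=> -[cc cv]; split=> //; last by right.
  case: cc => // -[cC nc]; exfalso; apply: (corner_not_new cC _ nv).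
  by apply: nv.1.2 cv; left.
split=> -[h1 h2 h3]; split=> //.
- by have [c cc cv] := h2; exists c => //; right.
- by move=> c; rewrite E h3.
- by have [c cc cv] := h2; have [] := (E c).1 (conj cc cv); exists c.
- by move=> c; rewrite -E h3.
Qed.

Lemma new_vertex_block_exists v : new_vertex v -> exists l r, block subdivided v l r.
Proof.
move=> nv; apply: (block_exists m' nv.1) => c c' d s cc cc' cv cv'.
exact: new_vertex_aligned nv cc cc' cv cv'.
Qed.

(** The new B-splines are refinements of the zero spline. *)
Lemma refine_spike v l r e : new_vertex v -> exists2 K, jet_spline subdivided K &
  (forall c p, subdivided c -> in_cell c p -> K p = jet (hermite c (spike v e l r)) p) /\
  forall w, vertex subdivided w -> K w = spike v e l r w.
Proof.
move=> nv; apply: (refine_jet_spline (jet_spline0 C)) => w _ nw.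
by rewrite /spike; case: eqP => // e'; subst w.
Qed.

End Step.

(** * Bases dual to the jets at the basis vertices *)

(** A basis function seen through its jets at the basis vertices, which is all that
    has to be known about it. *)
Definition localized C v (f : R * R -> R) (a b : 'cV[R]_2) : Prop := exists J,
  [/\ jet_spline C J, forall p, region C p -> f p = J p 0 0
    & forall w, full_vertex C w -> J w = if w == v then a *m b^T else 0].

(** The invariant of the construction.  The flags number the four functions of a
    vertex; the vectors depend on v because the extents of its block do. *)
Definition local_basis C (S : set (R * R -> R)) : Prop :=
  exists (beta : R * R -> bool * bool -> R * R -> R) (ax ay : R * R -> bool -> 'cV[R]_2),
  [/\ S = [set f | exists v e, full_vertex C v /\ f = beta v e],
      forall v, full_vertex C v -> unit_pair (ax v) /\ unit_pair (ay v)
    & forall v e, full_vertex C v -> localized C v (beta v e) (ax v e.1) (ay v e.2)].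

Section LocalBasis.
Variables (M : set (cell R)) (S : set (R * R -> R)).
Variables (beta : R * R -> bool * bool -> R * R -> R).
Variables (ax ay : R * R -> bool -> 'cV[R]_2).
Hypotheses (mM : is_mesh M).
Hypothesis SE : S = [set f | exists v e, full_vertex M v /\ f = beta v e].
Hypothesis hats : forall v, full_vertex M v -> unit_pair (ax v) /\ unit_pair (ay v).
Hypothesis loc : forall v e, full_vertex M v ->
  localized M v (beta v e) (ax v e.1) (ay v e.2).
Implicit Types (i : (R * R) * (bool * bool)).

(** In a basis dual to the jets, the coefficient of a spline at the index i is a
    linear functional of its jet at the vertex of i. *)
Definition coef J i : R := (dual_row (ax i.1) i.2.1 *m J i.1 *m (dual_row (ay i.1) i.2.2)^T) 0 0.

Lemma coefZ_sum (I : Type) (s : seq I) (k : I -> R) (F : I -> R * R -> 'M[R]_2) i :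
  coef (fun p => \sum_(j <- s) k j *: F j p) i = \sum_(j <- s) k j * coef (F j) i.
Proof.
rewrite /coef mulmx_sumr mulmx_suml summxE; apply: eq_bigr => j _.
by rewrite -scalemxAr -scalemxAl mxE.
Qed.

Lemma coef_spike J v w e e' : full_vertex M w ->
  J w = (if w == v then ax v e.1 *m (ay v e.2)^T else 0) ->
  coef J (w, e') = ((w == v) && (e' == e))%:R.
Proof.
move=> fw E; rewrite /coef /= E; case: eqP => [wv|_]; last by rewrite mulmx0 mul0mx mxE.
subst w; have [hx hy] := hats fw.
rewrite mulmxA -(mulmxA _ _ (_^T)) -trmx_mul !dual_rowK // mul_scalar_mx tr_scalar_mx mxE mxE eqxx.
by case: e e' {E} => [e1 e2] [e1' e2'] /=; rewrite xpair_eqE; case: eqP => _; case: eqP => _;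
  rewrite ?(mul0r, mul1r, mulr0, mulr1).
Qed.

Definition flag_pairs : seq (bool * bool) :=
  [:: (true, true); (true, false); (false, true); (false, false)].

(** The products of the two bases form a basis of the space of jets. *)
Lemma coef_total (J : R * R -> 'M[R]_2) w : full_vertex M w ->
  \sum_(e <- flag_pairs) coef J (w, e) *: (ax w e.1 *m (ay w e.2)^T) = J w.
Proof.
move=> fw; have [hx hy] := hats fw.
have E e : coef J (w, e) *: (ax w e.1 *m (ay w e.2)^T) =
   (ax w e.1 *m dual_row (ax w) e.1) *m J w *m (ay w e.2 *m dual_row (ay w) e.2)^T.
  rewrite /coef /=; set x := _ *m _ *m _.
  rewrite trmx_mul !mulmxA -(mulmxA _ _ (J w)) -(mulmxA _ _ (dual_row _ _)^T) -/x.
  (* The scalar x is a 1 x 1 matrix, which may be moved into the product. *)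
  by rewrite [x in RHS]mx11_scalar mul_mx_scalar -scalemxAl.
under eq_bigr do rewrite E.
rewrite !big_cons big_nil addr0 /=.
transitivity ((ax w true *m dual_row (ax w) true + ax w false *m dual_row (ax w) false) *m J w *m
  (ay w true *m dual_row (ay w) true + ay w false *m dual_row (ay w) false)^T).
  by rewrite linearD /= mulmxDr !mulmxDl !addrA; congr (_ + _); rewrite addrAC.
by rewrite !dual_row_total // trmx1 mul1mx mulmx1.
Qed.

(** Both sides are splines with the same jets at all basis vertices. *)
Lemma expansion : exists idx : seq ((R * R) * (bool * bool)),
  [/\ uniq idx, forall i, i \in idx <-> full_vertex M i.1
    & forall J, jet_spline M J -> forall p, region M p ->
       J p 0 0 = \sum_(i <- idx) coef J i * beta i.1 i.2 p].
Proof.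
have [s0 Es] := (finite_seqP _).1 (finite_full_vertex mM); pose s := undup s0.
have sP v : v \in s <-> full_vertex M v.
  rewrite mem_undup; have : [set v | full_vertex M v] v = [set` s0] v by rewrite Es.
  by move=> /= ->.
have us : uniq s by exact: undup_uniq.
pose idx := [seq (v, e) | v <- s, e <- flag_pairs].
have idxP i : i \in idx <-> full_vertex M i.1.
  split=> [/allpairsP[[v e] [/= vs _ ->]]|/sP vs]; first exact/sP.
  by apply/allpairsP; exists i; split=> //; [case: (i.2) => [] [] []|case: (i)].
exists idx; split=> //; first by apply: allpairs_uniq => // -[? ?] [? ?].
move=> J sJ p pr.
have HK i : exists K, full_vertex M i.1 -> [/\ jet_spline M K,
    forall p, region M p -> beta i.1 i.2 p = K p 0 0
  & forall w, full_vertex M w -> K w = if w == i.1 then ax i.1 i.2.1 *m (ay i.1 i.2.2)^T else 0].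
  have [fi|nf] := pselect (full_vertex M i.1); last by exists (fun=> 0).
  by have [K HK] := loc i.2 fi; exists K.
have /choice[K {}HK] := HK.
(* Jet fields of the basis functions, set to 0 for indices that do not occur. *)
pose K' i p := if `[< full_vertex M i.1 >] then K i p else 0.
have sK' i : jet_spline M (K' i).
  rewrite /K'; case: asboolP => [fi|_]; [by have [] := HK i fi|exact: jet_spline0].
have D : jet_spline M (fun p => J p + (-1) *: (\sum_(i <- idx) coef J i *: K' i p)).
  by apply: jet_splineD => //; apply: jet_splineZ; exact: jet_spline_sum.
have Z : forall w, full_vertex M w -> J w + (-1) *: (\sum_(i <- idx) coef J i *: K' i w) = 0.
  move=> w fw; rewrite scaleN1r; apply/eqP; rewrite subr_eq0; apply/eqP.
  rewrite big_allpairs (bigD1_seq w) /=; [|exact/sP|exact: us].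
  rewrite [X in _ + X](_ : _ = 0) ?addr0.
    rewrite -[LHS](coef_total _ fw); apply: eq_bigr => e _; congr (_ *: _).
    by rewrite /K' asboolT //=; have [_ _ ->] := HK (w, e) fw; rewrite //= eqxx.
  rewrite big_seq_cond; apply: big1 => v /andP[/sP fv vw]; apply: big1 => e _.
  rewrite /K' asboolT //=.
  by have [_ _ ->] := HK (v, e) fv; rewrite //= eq_sym (negPf vw) scaler0.
have /(_ p pr)/matrixP/(_ 0 0) := jet_spline_unique mM D Z.
rewrite scaleN1r mxE [X in _ + X]mxE => /eqP; rewrite mxE subr_eq0 => /eqP ->.
rewrite summxE !big_seq; apply: eq_bigr => i /idxP fi; rewrite mxE /K' asboolT //.
by have [_ bK _] := HK i fi; rewrite bK.
Qed.

(** A function has only one jet field, so J may be replaced by the field that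
    [local_basis] provides. *)
Lemma coef_beta v e w e' J : full_vertex M v -> full_vertex M w -> jet_spline M J ->
  (forall p, region M p -> beta v e p = J p 0 0) ->
  coef J (w, e') = ((w == v) && (e' == e))%:R.
Proof.
move=> fv fw sJ bJ; have [K [sK bK HK]] := loc e fv.
apply: coef_spike => //; rewrite -HK //.
have Z := jet_spline_value_eq0 mM (jet_splineD sJ (jet_splineZ (-1) sK)).
apply/eqP; rewrite -subr_eq0 -scaleN1r; apply/eqP/Z; last exact: full_vertex_region.
by move=> p pr; rewrite scaleN1r mxE [X in _ + X]mxE -bJ // bK // subrr.
Qed.

Lemma beta_inj v e v' e' : full_vertex M v -> full_vertex M v' ->
  beta v e = beta v' e' -> (v, e) = (v', e').
Proof.
move=> fv fv' E; have [J [sJ bJ _]] := loc e fv.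
have := coef_beta e fv fv sJ bJ; rewrite E in bJ.
rewrite (coef_beta (e := e') e fv' fv sJ bJ) !eqxx /=.
by case: eqP => [->|_]; [case: eqP => [->|_]|]; rewrite //= => /eqP; rewrite eq_sym oner_eq0.
Qed.

Lemma local_independent : independent (region M) S.
Proof.
move=> n b a binj Sb H.
have {Sb}/choice[i Hi] : forall k, exists i, full_vertex M i.1 /\ b k = beta i.1 i.2.
  by move=> k; have := Sb k; rewrite SE => -[v [e [fv E]]]; exists (v, e).
have /choice[J HJ] : forall k, exists J, jet_spline M J /\ forall p, region M p -> b k p = J p 0 0.
  by move=> k; have [fk ->] := Hi k; have [J [sJ bJ _]] := loc (i k).2 fk; exists J.
move=> k; have [fk bk] := Hi k.
pose G p := \sum_(j <- index_enum 'I_n) a j *: J j p.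
have Z : G (i k).1 = 0.
  apply: (@jet_spline_value_eq0 M G mM _ _ _ (full_vertex_region mM fk)).
    by apply: jet_spline_sum => j; have [] := HJ j.
  move=> p pr; rewrite summxE -[RHS](H p pr); apply: eq_bigr => j _.
  by rewrite mxE; have [_ ->] := HJ j.
have : coef G (i k) = 0.
  by rewrite /coef Z mulmx0 mul0mx mxE.
rewrite coefZ_sum (bigD1 k) //= big1 ?addr0.
  have [sJ bJ] := HJ k; rewrite [i k]surjective_pairing (coef_beta (v := (i k).1) (e := (i k).2)) //.
    by rewrite !eqxx mulr1.
  by move=> p pr; rewrite -bk bJ.
move=> j jk; have [fj bj] := Hi j; have [sJ bJ] := HJ j.
rewrite [i k]surjective_pairing (coef_beta (v := (i j).1) (e := (i j).2)) //.
  rewrite -xpair_eqE -!surjective_pairing; case: eqP => [E|_]; last by rewrite mulr0.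
  by move/eqP: jk; case; apply: binj; rewrite bk bj E.
by move=> p pr; rewrite -bj bJ.
Qed.

Lemma local_span : span (region M) S = spline_space 3 3 1 1 M.
Proof.
apply/seteqP; split=> [f [n [b [a [Sb E]]]]|f /(jet_of_spline mM)[J sJ fJ]].
  have /choice[J HJ] : forall k, exists J, jet_spline M J /\ forall p, region M p ->
    b k p = J p 0 0.
    move=> k; have := Sb k; rewrite SE => -[v [e [fv ->]]].
    by have [J [sJ bJ _]] := loc e fv; exists J.
  apply: (spline_of_jet mM (J := fun p => \sum_(j <- index_enum 'I_n) a j *: J j p)).
    by apply: jet_spline_sum => j; have [] := HJ j.
  move=> p pr; rewrite E // summxE; apply: eq_bigr => j _.
  by rewrite mxE; have [_ ->] := HJ j.
have [idx [_ idxP X]] := expansion.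
pose i0 : (R * R) * (bool * bool) := ((0, 0), (true, true)); pose i k := nth i0 idx k.
exists (size idx), (fun k => beta (i k).1 (i k).2), (fun k => coef J (i k)); split=> [k|p pr].
  by rewrite SE; exists (i k).1, (i k).2; split=> //; apply/idxP; exact: mem_nth.
by rewrite fJ // X // (big_nth i0) big_mkord.
Qed.

(** Expand the constant 1.  The sum over the set S equals the sum over the
    indices because different indices give different functions. *)
Lemma local_partition_of_unity p : region M p -> \sum_(f \in S) f p = 1.
Proof.
move=> pr; have [idx [uidx idxP X]] := expansion.
have -> : S = [set` [seq beta i.1 i.2 | i <- idx]].
  apply/seteqP; rewrite SE; split=> [f [v [e [fv ->]]]|f /=].
    by apply/mapP; exists (v, e) => //; exact/idxP.
  by move=> /mapP[[v e] /idxP fv ->]; exists v, e.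
rewrite -fsbig_seq; last first.
  rewrite map_inj_in_uniq // => -[v e] [v' e'] /idxP fv /idxP fv' /=.
  exact: beta_inj.
rewrite big_map /=.
have one q : jet (delta_mx (inord 0) (inord 0)) q = delta_mx 0 0.
  apply/matrixP => k l; rewrite jet_entry !sum4 !mxE !inordK //=.
  rewrite -!val_eqE /= !inordK //= !(mulr0, mul0r, addr0, mulr1).
  by move: k l; apply: ord2P; apply: ord2P; rewrite /= ?(expr0, mulr1n, mulr0n, mulr1, mulr0, mul0r).
have s1 : jet_spline M (fun=> delta_mx 0 0).
  by exists (fun=> delta_mx (inord 0) (inord 0)) => c q _ _; rewrite one.
have := X _ s1 p pr; rewrite mxE /= => X1; rewrite -[RHS]mulr1n X1.
rewrite !big_seq; apply: eq_bigr => -[v e] /idxP /= fv.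
have [hx hy] := hats fv; rewrite /coef /=.
have -> : delta_mx 0 0 = (delta_mx 0 0 : 'cV[R]_2) *m (delta_mx 0 0 : 'cV[R]_2)^T.
  by rewrite trmx_delta mul_delta_mx.
by rewrite mulmxA dual_row_unit // mul1mx -trmx_mul dual_row_unit // trmx1 mxE eqxx mul1r.
Qed.

End LocalBasis.

(** * The basis of a hierarchy of meshes *)

Lemma grid_cover b (s : seq R) x : (1 < size s)%N ->
  half_open b (s`_0, s`_(size s).-1) x ->
  exists2 i, (i.+1 < size s)%N & half_open b (s`_i, s`_i.+1) x.
Proof.
move=> s1; suff H k : (k < size s)%N -> half_open b (s`_0, s`_k) x ->
    exists2 i, (i.+1 < size s)%N & half_open b (s`_i, s`_i.+1) x.
  by apply: H; rewrite prednK // ltnW.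
elim: k => [|k IH] ks hk; first by move: (half_open_lt hk); rewrite /= ltxx.
have [/IH|] := boolP (half_open b (s`_0, s`_k) x); first by apply; exact: ltnW.
move=> nk; exists k => //; move: hk nk; case: (b) => /= /andP[h1 h2]; rewrite ?h1 ?h2 ?andbT /=.
  by rewrite -leNgt.
by rewrite -ltNge.
Qed.

Lemma grid_unique b (s : seq R) i j x : sorted <%R s ->
  (i.+1 < size s)%N -> (j.+1 < size s)%N ->
  half_open b (s`_i, s`_i.+1) x -> half_open b (s`_j, s`_j.+1) x -> i = j.
Proof.
move=> ss; wlog: i j / (i <= j)%N => [W|].
  by case/orP: (leq_total i j) => ij si sj hi hj; [exact: W|apply/esym/W].
rewrite leq_eqVlt => /orP[/eqP //|ij] si sj hi hj; exfalso.
have l := sorted_le ss ij (ltnW sj).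
move: hi hj; case: (b) => /= /andP[h1 h2] /andP[h3 h4].
  by move: (lt_le_trans h2 (le_trans l h3)); rewrite ltxx.
by move: (lt_le_trans h3 (le_trans h2 l)); rewrite ltxx.
Qed.

Lemma side_tensor_mesh c d : tensor_mesh xs ys c -> exists2 i, (i.+1 < size (grid d))%N &
  side d c = ((grid d)`_i, (grid d)`_i.+1).
Proof. by move=> [i [j [si sj ->]]]; case: d; [exists j|exists i]. Qed.

Lemma tensor_mesh_is_mesh : is_mesh (tensor_mesh xs ys).
Proof.
split.
- have := finite_image (fun x => Cell xs`_x.1 xs`_x.1.+1 ys`_x.2 ys`_x.2.+1)
    (finite_setX (finite_II (size xs)) (finite_II (size ys))).
  apply: sub_finite_set => c [i [j [si sj ->]]]; exists (i, j) => //=.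
  by split; exact: ltnW.
- move=> c d /(side_tensor_mesh d)[i si ->]; exists 0%N, i, [::]; split=> //.
- move=> s p q.
  have H d : exists2 i, (i.+1 < size (grid d))%N &
    half_open (s d) ((grid d)`_i, (grid d)`_i.+1) (coordinate d p).
    by apply: grid_cover (size_grid d) _; rewrite -side_domain; exact: q.
  have [i si hi] := H false; have [j sj hj] := H true.
  by exists (Cell xs`_i xs`_i.+1 ys`_j ys`_j.+1); [exists i, j|case].
move=> s p c c' cc c'c q q'; apply: cell_eq => d.
have := q d; have := q' d.
have [i si ->] := side_tensor_mesh d cc; have [j sj ->] := side_tensor_mesh d c'c => hj hi.
by rewrite (grid_unique (sorted_grid d) si sj hi hj).
Qed.

(** All sides have depth 0, so none of them contains a knot strictly inside. *)
Lemma tensor_full_vertex v : vertex (tensor_mesh xs ys) v -> full_vertex (tensor_mesh xs ys) v.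
Proof.
have m := tensor_mesh_is_mesh.
have dy c d : tensor_mesh xs ys c -> dyadic (grid d) 0 (side d c).
  by move=> /(side_tensor_mesh d)[i si ->]; exists i, [::].
move=> [c cc cv]; split; first exact: mesh_in_domain cc (corner_in (mesh_lt m cc) cv).
move=> c' c'c c'v; apply/cornerP => d; have [//|st] := at_end_or_inside d c'v.
move/cornerP: cv => /(_ d) e.
by have := dyadic_inside (sorted_grid d) (dy c' d c'c) (dy c d cc) st e.
Qed.

Lemma tensor_mesh_aligned v : aligned (tensor_mesh xs ys) v.
Proof.
have m := tensor_mesh_is_mesh; move=> c c' d s cc c'c _ _ e e'.
have h : half_open s (side d c) (coordinate d v) by rewrite e;
  exact: half_open_near_end (mesh_lt m cc d).
have h' : half_open s (side d c') (coordinate d v) by rewrite e';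
  exact: half_open_near_end (mesh_lt m c'c d).
have [i si E] := side_tensor_mesh d cc; have [j sj E'] := side_tensor_mesh d c'c.
by rewrite E E' in h h' *; rewrite (grid_unique (sorted_grid d) si sj h h').
Qed.

Lemma local_basis_tensor_mesh : local_basis (tensor_mesh xs ys)
  (\bigcup_(v in vertex (tensor_mesh xs ys)) vertex_functions (tensor_mesh xs ys) v).
Proof.
have m := tensor_mesh_is_mesh; set T := tensor_mesh xs ys.
have /choice[l /choice[r Hlr]] : forall v, exists l, exists r, vertex T v -> block T v l r.
  move=> v; have [vv|nn] := pselect (vertex T v); last by exists (fun=> 0), (fun=> 0).
  by have [l [r B]] := block_exists m (tensor_full_vertex vv) (tensor_mesh_aligned (v := v));
    exists l, r.
exists (fun v e => vertex_bspline e.1 e.2 (l v false) (r v false) (l v true) (r v true) v).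
exists (fun v e => knot_jet e (l v false) v.1 (r v false)).
exists (fun v e => knot_jet e (l v true) v.2 (r v true)).
split.
- apply/seteqP; split=> f.
    move=> [v vv [sl [sr [tl [tr [B [e1 [e2 ->]]]]]]]]; exists v, (e1, e2).
    have fv := tensor_full_vertex vv; split=> //.
    by have [El Er] := block_unique m ((vertex_blockP _ _ _ _ _ _).1 B) (Hlr v vv); rewrite -El -Er.
  move=> [v [e [fv ->]]]; have vv := full_vertex_vertex m fv; exists v => //.
  exists (l v false), (r v false), (l v true), (r v true); split; last by exists e.1, e.2.
  by apply/vertex_blockP; have := Hlr v vv; congr block; apply/funext; case.
- move=> v fv; have B := Hlr v (full_vertex_vertex m fv).
  by split; apply: unit_pair_knot_jet; exact: (block_lt m fv _ B).
move=> v e fv; have B := Hlr v (full_vertex_vertex m fv).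
have [K sK HK] : exists2 K, jet_spline T K & forall c p, T c -> in_cell c p ->
    K p = jet (hermite c (spike v e (l v) (r v))) p.
  apply: (jet_spline_glue (J := spike v e (l v) (r v)) m) =>
    c w cc cw /tensor_full_vertex[_ /(_ c cc cw) cw'].
  exact: (jet_hermite_corner _ m cc).
exists K; split=> //.
  by move=> p [c cc cp]; rewrite (HK c) //; exact: (vertex_bspline_jet m fv e B).
move=> w [wd F]; have [c cc cw] := full_vertex_region m (conj wd F).
by rewrite (HK c) // (jet_hermite_corner _ m cc) //; exact: F.
Qed.

(** By [modify_value] an old function keeps its jets at the old basis vertices and
    gets the jet 0 at the new ones.  By [refine_spike] a new B-spline has its only
    nonzero jet at its own vertex. *)
Lemma local_basis_step (C Th : set (cell R)) (ty : cell R -> subdivision) (V : set (R * R))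
    (S : set (R * R -> R)) :
  is_mesh C -> Th `<=` C ->
  (forall v, full_vertex (subdivided C Th ty) v -> ~ full_vertex C v -> ~ vertex C v) ->
  V = new_vertex C Th ty -> local_basis C S ->
  local_basis (subdivided C Th ty)
    ([set modify Th ty V b | b in S] `|` \bigcup_(v in V) vertex_functions (pieces_of Th ty) v).
Proof.
move=> m ThC nop VE [beta [ax [ay [SE hats loc]]]]; set C' := subdivided C Th ty.
have m' : is_mesh C' := subdivided_mesh ty m ThC.
have /choice[l /choice[r Hlr]] : forall v, exists l, exists r, new_vertex C Th ty v ->
  block C' v l r.
  move=> v; have [nv|nn] := pselect (new_vertex C Th ty v); last by exists (fun=> 0), (fun=> 0).
  by have [l [r B]] := new_vertex_block_exists m ThC nop nv; exists l, r.
pose spl e v := vertex_bspline e.1 e.2 (l v false) (r v false) (l v true) (r v true) v.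
exists (fun v e => if `[< full_vertex C v >] then modify Th ty V (beta v e) else spl e v).
exists (fun v e => if `[< full_vertex C v >] then ax v e else knot_jet e (l v false) v.1 (r v false)).
exists (fun v e => if `[< full_vertex C v >] then ay v e else knot_jet e (l v true) v.2 (r v true)).
have old_full v : full_vertex C v -> full_vertex C' v by exact: full_vertex_subdivided.
split.
- apply/seteqP; split=> f.
    case=> [[b + <-]|[v nv [sl [sr [tl [tr [B [e1 [e2 ->]]]]]]]]].
      rewrite SE => -[v [e [fv ->]]]; exists v, e; split; first exact: old_full.
      by rewrite asboolT.
    rewrite VE in nv; exists v, (e1, e2); split; first exact: nv.1.
    rewrite asboolF; last exact: nv.2.
    have B' := (new_vertex_blockE nop _ _ nv).1 ((vertex_blockP _ _ _ _ _ _).1 B).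
    have [El Er] := block_unique m' B' (Hlr v nv).
    by rewrite /spl -El -Er.
  move=> [v [e [fv ->]]]; case: asboolP => [ofv|nfv].
    by left; exists (beta v e) => //; rewrite SE; exists v, e.
  have nv : new_vertex C Th ty v by split.
  right; exists v; first by rewrite VE.
  exists (l v false), (r v false), (l v true), (r v true); split; last by exists e.1, e.2.
  apply/vertex_blockP; apply/(new_vertex_blockE nop) => //.
  have := Hlr v nv; congr block; apply/funext; by case.
- move=> v fv; case: asboolP => [ofv|nfv]; first exact: hats.
  have nv : new_vertex C Th ty v by split.
  have B := Hlr v nv; split; apply: unit_pair_knot_jet; first exact: (block_lt m' fv false B).
  exact: (block_lt m' fv true B).
move=> v e fv; case: asboolP => [ofv|nfv].
  have [J [sJ bJ HJ]] := loc v e ofv.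
  have [K sK [KH Kv]] := refine_reset_jets m ThC nop sJ.
  exists K; split=> //.
    by move=> p pr; rewrite VE; apply: (modify_value m ThC nop _ sJ bJ KH).
  move=> w fw; rewrite Kv; last exact: full_vertex_vertex.
  rewrite /reset_jets; case: asboolP => [nw|nw].
    by case: eqP => // wv; subst w; case: nw.2.
  by rewrite HJ //; apply: contrapT => h; apply: nw.
have nv : new_vertex C Th ty v by split.
have [K sK [KH Kv]] := refine_spike m ThC nop (l v) (r v) e nv.
exists K; split=> //.
  move=> p [c cc cp]; rewrite (KH c) //.
  exact: (vertex_bspline_jet m' fv e (Hlr v nv)).
by move=> w fw; rewrite Kv //; exact: full_vertex_vertex.
Qed.

(** A fresh cell is a cell of the mesh, so each step is a refinement step as
    above. *)
Lemma hierarchy_basis N (Theta : nat -> set (cell R)) (tau : nat -> cell R -> subdivision) :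
  (forall k, (k < N)%N -> Theta k `<=` fresh xs ys Theta tau k) ->
  (forall k v, (k < N)%N -> T_vertex (mesh xs ys Theta tau k) v ->
     ~ crossing_vertex (mesh xs ys Theta tau k.+1) v) ->
  forall k, (k <= N)%N -> is_mesh (mesh xs ys Theta tau k) /\
    local_basis (mesh xs ys Theta tau k) (basis xs ys Theta tau k).
Proof.
move=> hTheta hT; elim=> [|k IH] kN.
  by split; [exact: tensor_mesh_is_mesh|exact: local_basis_tensor_mesh].
have [m lb] := IH (ltnW kN).
have ThC : Theta k `<=` mesh xs ys Theta tau k.
  by move=> t /(hTheta _ kN) ft; case: (k) ft => [//|k' ft]; right.
have m' : is_mesh (mesh xs ys Theta tau k.+1) by exact: subdivided_mesh m ThC.
split=> //; apply: local_basis_step => //.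
  move=> v fv nfv vv; have Tv := T_vertexP m vv nfv.
  apply: (hT k v kN Tv); apply/(crossing_vertexP _ m'); split=> //.
  by rewrite (regionE m') -(regionE m); exact: Tv.1.2.
apply/seteqP; split=> v [h1 h2].
  split; first by apply/(basis_vertexP _ m').
  by move=> fv; apply: h2; apply/(basis_vertexP _ m).
split; first by apply/(basis_vertexP _ m').
by move=> /(basis_vertexP _ m).
Qed.

End Mesh.
End ModifiedPHT.

Theorem theorem6 (R : realType) (xs ys : seq R) (N : nat)
    (Theta : nat -> set (cell R)) (tau : nat -> cell R -> subdivision)
    (hxs : (1 < size xs)%N) (hys : (1 < size ys)%N)
    (sxs : sorted <%R xs) (sys : sorted <%R ys)
    (hTheta : forall k, (k < N)%N -> Theta k `<=` fresh xs ys Theta tau k)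
    (hT : forall k v, (k < N)%N -> T_vertex (mesh xs ys Theta tau k) v ->
            ~ crossing_vertex (mesh xs ys Theta tau k.+1) v)
    (hnew : forall k t, (k < N)%N -> Theta k t ->
            exists v, new_basis_vertex xs ys Theta tau k v /\ in_cell t v) :
  let TN := mesh xs ys Theta tau N in
  let S := basis xs ys Theta tau N in
  [/\ independent (region TN) S,
      span (region TN) S = spline_space 3 3 1 1 TN
    & forall p, region TN p -> \sum_(b \in S) b p = 1].
Proof.
move=> TN S; have [m [beta [ax [ay [SE hats loc]]]]] :=
  hierarchy_basis hxs hys sxs sys hTheta hT (leqnn N).
split.
- exact: local_independent m SE hats loc.
- exact: local_span m SE hats loc.
- exact: local_partition_of_unity m SE hats loc.
Qed.
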